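(* Let $\mathcal B=\coprod_{\alpha\in Q_+}\mathrm{Irr}\,\mathcal N_\alpha$. The maps $\mathrm{wt}$, $\varepsilon'_i$, $\varphi_i$, $\tilde f_i$, $\tilde e_i$ $(i\in I)$ define a $U_q(\mathfrak g)$-crystal structure on $\mathcal B$ (with $\varepsilon_i'$ as the crystal function ''$\varepsilon_i$'').
   Context: **Quiver and matrix.** All varieties and vector spaces are over $\mathbb C$. $I$ is a finite or countably infinite set of vertices, $H$ a set of arrows with maps $\mathrm{out},\mathrm{in}:H\to I$ and a fixed-point-free involution $h\mapsto\bar h$ with $\mathrm{out}(\bar h)=\mathrm{in}(h)$, and $\Omega\subset H$ satisfies $H=\Omega\sqcup\overline\Omega$. Write $h:i\to j$ if $\mathrm{out}(h)=i$, $\mathrm{in}(h)=j$; $h$ is a loop if $\mathrm{out}(h)=\mathrm{in}(h)$; $\overline\Omega^{loop}$ is the set of loops in $\overline\Omega$. Let $c_{ij}$ be the (finite) number of arrows in $H$ from $i$ to $j$, $a_{ii}=2-c_{ii}$, $a_{ij}=-c_{ij}$ for $i\ne j$, $A=(a_{ij})$. An index $i$ is real ($i\in I^{re}$) if $a_{ii}=2$ and imaginary ($i\in I^{im}$) if $a_{ii}\le0$. Fix a Borcherds-Cartan datum $(A,P,\Pi,\Pi^\vee)$: $P$ a free abelian group, $\Pi=\{\alpha_i\}_{i\in I}\subset P$ linearly independent, $\Pi^\vee=\{h_i\}_{i\in I}\subset P^\vee=\mathrm{Hom}(P,\mathbb Z)$, $\langle h_i,\alpha_j\rangle=a_{ij}$,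 and for each $i$ there is $\Lambda_i\in P$ with $\langle h_j,\Lambda_i\rangle=\delta_{ij}$ for all $j$. $Q_+=\sum_i\mathbb Z_{\ge0}\alpha_i$. **The variety $\mathcal N_\alpha$.** For $\alpha=\sum d_i\alpha_i\in Q_+$ let $V_\alpha=\bigoplus_iV_i$ with $\dim V_i=d_i$ and $X_\alpha=\bigoplus_{h\in H}\mathrm{Hom}(V_{\mathrm{out}(h)},V_{\mathrm{in}(h)})$. Put $\varepsilon(h)=1$ for $h\in\Omega$, $-1$ for $h\in\overline\Omega$, and $\mu_i(B)=\sum_{\mathrm{out}(h)=i}\varepsilon(h)B_{\bar h}B_h\in\mathrm{End}\,V_i$. $\mathcal N_\alpha$ is the variety of $B=(B_h)_{h\in H}\in X_\alpha$ such that: (i) there is a complete flag $0=F_0\subset F_1\subset F_2\subset\cdots$ of $I$-graded subspaces of $V_\alpha$ with $B_h(F_k)\subset F_k$ for $h\in\overline\Omega^{loop}$ and $B_h(F_k)\subset F_{k-1}$ for $h\in H\setminus\overline\Omega^{loop}$ ($B_h$ being extended by $0$ to $V_\alpha$); (ii) $\mu_i(B)=0$ for all $i$; (iii) $B_h$ is regular semisimple (diagonalizable with distinct eigenvalues) for all $h\in\overline\Omega^{loop}$. $\mathrm{Irr}\,\mathcal N_\alpha$ is its set of irreducible components. **The maps.** For $B\in\mathcal N_\alpha$ let $\mathbb C\langle B\rangle_i\subset\mathrm{End}(V_i)$ be the unital subalgebra generated by all $B_h$, $h$ a loop at $i$ in $H$; $W_i(B)=\mathbb C\langle B\rangle_i\cdot\sum_{h:j\to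 i,\,j\ne i}\mathrm{Im}\,B_h$, $\varepsilon_i(B)=\mathrm{codim}_{V_i}W_i(B)$. For $\Lambda\in\mathrm{Irr}\,\mathcal N_\alpha$, $\varepsilon_i(\Lambda)=\varepsilon_i(B)$ for generic $B\in\Lambda$. If $\varepsilon_i(\Lambda)=l$, let $\tilde e_i^{\,l}(\Lambda)\subset\mathcal N_{\alpha-l\alpha_i}$ be the closure of the set of all representations on $V_{\alpha-l\alpha_i}$ isomorphic to the restriction of some $B\in\Lambda$ with $\varepsilon_i(B)=l$ to $W_i(B)\oplus\bigoplus_{j\ne i}V_j$. This defines a bijection $\tilde e_i^{\,l}$ from $\{\Lambda\in\mathrm{Irr}\,\mathcal N_\alpha:\varepsilon_i(\Lambda)=l\}$ to $\{\Lambda'\in\mathrm{Irr}\,\mathcal N_{\alpha-l\alpha_i}:\varepsilon_i(\Lambda')=0\}$. Put $\tilde e_i\Lambda=(\tilde e_i^{\,l-1})^{-1}\tilde e_i^{\,l}(\Lambda)$ if $\varepsilon_i(\Lambda)=l>0$, $\tilde e_i\Lambda=0$ if $\varepsilon_i(\Lambda)=0$, $\tilde f_i\Lambda=(\tilde e_i^{\,l+1})^{-1}\tilde e_i^{\,l}(\Lambda)$ if $\varepsilon_i(\Lambda)=l$. For $\Lambda\in\mathrm{Irr}\,\mathcal N_\alpha$: $\mathrm{wt}(\Lambda)=-\alpha$; $\varepsilon'_i(\Lambda)=\varepsilon_i(\Lambda)$ if $i\in I^{re}$, $0$ if $i\in I^{im}$; $\varphi_i(\Lambda)=\langle h_i,\mathrm{wt}(\Lambda)\rangle+\varepsilon_i'(\Lambda)$.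 **Abstract crystals.** A $U_q(\mathfrak g)$-crystal is a set $B$ with maps $\mathrm{wt}:B\to P$, $\tilde e_i,\tilde f_i:B\to B\sqcup\{0\}$, $\varepsilon_i,\varphi_i:B\to\mathbb Z\sqcup\{-\infty\}$ $(i\in I)$ such that: $\mathrm{wt}(\tilde e_ib)=\mathrm{wt}(b)+\alpha_i$ if $\tilde e_ib\ne0$; $\mathrm{wt}(\tilde f_ib)=\mathrm{wt}(b)-\alpha_i$ if $\tilde f_ib\ne0$; $\varphi_i(b)=\varepsilon_i(b)+\langle h_i,\mathrm{wt}(b)\rangle$; for $b,b'\in B$, $\tilde f_ib=b'$ iff $b=\tilde e_ib'$; if $\tilde e_ib\ne0$ then $\varepsilon_i(\tilde e_ib)=\varepsilon_i(b)-1$, $\varphi_i(\tilde e_ib)=\varphi_i(b)+1$ for $i\in I^{re}$ and $\varepsilon_i(\tilde e_ib)=\varepsilon_i(b)$, $\varphi_i(\tilde e_ib)=\varphi_i(b)+a_{ii}$ for $i\in I^{im}$; if $\tilde f_ib\ne0$ then $\varepsilon_i(\tilde f_ib)=\varepsilon_i(b)+1$, $\varphi_i(\tilde f_ib)=\varphi_i(b)-1$ for $i\in I^{re}$ and $\varepsilon_i(\tilde f_ib)=\varepsilon_i(b)$, $\varphi_i(\tilde f_ib)=\varphi_i(b)-a_{ii}$ for $i\in I^{im}$; if $\varphi_i(b)=-\infty$ then $\tilde e_ib=\tilde f_ib=0$. *)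

(* Defs.v *)
From HB Require Import structures.
From mathcomp Require Import all_boot all_order all_algebra.
From mathcomp Require Import finmap.
From mathcomp Require Import boolp classical_sets.

Set Implicit Arguments.
Unset Strict Implicit.
Unset Printing Implicit Defensive.

Import GRing.Theory Num.Theory.
Local Open Scope classical_set_scope.
Local Open Scope ring_scope.

(* The arrow set H is given as the family of its finite parts
   [arr i j] = {h in H | out h = i, in h = j}; [inOmega] is the indicator of
   Omega. *)
Record quiver (I : countType) := Quiver {
  arr : I -> I -> finType;
  bar : forall i j, arr i j -> arr j i;
  inOmega : forall i j, pred (arr i j);
  barK : forall i j (h : arr i j), bar (bar h) = h;
  bar_neq : forall i (h : arr i i), bar h != h;
  Omega_bar : forall i j (h : arr i j), inOmega (bar h) = ~~ inOmega h
}.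

Definition cartan (I : countType) (Q : quiver I) (i j : I) : int :=
  if i == j then 2 - #|arr Q i i|%:Z else - #|arr Q i j|%:Z.

Definition Zfree (P : zmodType) (J : choiceType) (b : J -> P) : Prop :=
  forall (s : {fset J}) (c : J -> int),
    \sum_(j <- s) b j *~ c j = 0 -> forall j, j \in s -> c j = 0.

Definition Zgenerates (P : zmodType) (J : choiceType) (b : J -> P) : Prop :=
  forall x : P, exists (s : {fset J}) (c : J -> int),
    x = \sum_(j <- s) b j *~ c j.

Definition free_abelian (P : zmodType) : Prop :=
  exists (J : choiceType) (b : J -> P), Zfree b /\ Zgenerates b.

Record BC_datum (I : countType) (A : I -> I -> int) := BCDatum {
  wlat : zmodType;
  sroot : I -> wlat;
  coroot : I -> {additive wlat -> int};
  wlat_free : free_abelian wlat;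
  sroot_free : Zfree sroot;
  coroot_sroot : forall i j, coroot i (sroot j) = A i j;
  fund_weight : forall i, exists L : wlat, forall j, coroot j L = (j == i)%:R
}.

(* [None] is the added element 0 in the codomain of e, f, and -oo in the
   codomain of eps, phi; so [omap (fun x => x + n)] is addition of n, with
   -oo + n = -oo. *)
Record is_crystal (I : countType) (A : I -> I -> int) (D : BC_datum A)
    (B : Type) (wt : B -> wlat D) (e f : I -> B -> option B)
    (eps phi : I -> B -> option int) : Prop := IsCrystal {
  crystal_wt_e : forall i b b',
    e i b = Some b' -> wt b' = wt b + sroot D i;
  crystal_wt_f : forall i b b',
    f i b = Some b' -> wt b' = wt b - sroot D i;
  crystal_phi : forall i b,
    phi i b = omap (fun x => x + coroot D i (wt b)) (eps i b);
  crystal_ef : forall i b b', f i b = Some b' <-> e i b' = Some b;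
  crystal_e_re : forall i b b', A i i = 2 -> e i b = Some b' ->
    eps i b' = omap (fun x => x - 1) (eps i b) /\
    phi i b' = omap (fun x => x + 1) (phi i b);
  crystal_e_im : forall i b b', A i i <= 0 -> e i b = Some b' ->
    eps i b' = eps i b /\ phi i b' = omap (fun x => x + A i i) (phi i b);
  crystal_f_re : forall i b b', A i i = 2 -> f i b = Some b' ->
    eps i b' = omap (fun x => x + 1) (eps i b) /\
    phi i b' = omap (fun x => x - 1) (phi i b);
  crystal_f_im : forall i b b', A i i <= 0 -> f i b = Some b' ->
    eps i b' = eps i b /\ phi i b' = omap (fun x => x - A i i) (phi i b);
  crystal_ninfty : forall i b, phi i b = None -> e i b = None /\ f i b = None
}.

(* Elements sum_i d_i alpha_i of Q_+ are represented by their coefficients,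
   which is harmless because the alpha_i are linearly independent. *)
Notation dimv I := {fsfun I -> nat with 0%N}.

Definition dimv_sub (I : countType) (d : dimv I) (i : I) (l : nat) : dimv I :=
  [fsfun j in finsupp d => if j == i then (d j - l)%N else d j].

Definition root_of (I : countType) (A : I -> I -> int) (D : BC_datum A)
  (d : dimv I) : wlat D := \sum_(i <- finsupp d) sroot D i *+ d i.

Definition pick_opt (T : Type) (P : T -> Prop) : option T :=
  match pselect (exists x, P x) with
  | left exP => Some (projT1 (cid exP))
  | right _ => None
  end.

Section LinearAlgebra.
Variable K : fieldType.

Definition is_subspace (V : lmodType K) (S : set V) : Prop :=
  S 0 /\ forall (a : K) u v, S u -> S v -> S (a *: u + v).

Definition lin_span (V : lmodType K) (S : set V) : set V :=
  smallest (@is_subspace V) S.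

Definition is_unital_subalg n (S : set 'M[K]_n) : Prop :=
  [/\ is_subspace S, S 1%:M & forall a b, S a -> S b -> S (a *m b)].

Definition subalg_gen n (S : set 'M[K]_n) : set 'M[K]_n :=
  smallest (@is_unital_subalg n) S.

Definition rowspace m n (M : 'M[K]_(m, n)) : set 'rV[K]_n :=
  [set v | (v <= M)%MS].

Definition mx_of_rowspace n (S : set 'rV[K]_n) : 'M[K]_n :=
  xget 0 [set M | rowspace M = S].

Definition regular_semisimple n (M : 'M[K]_n) : Prop :=
  exists (g : 'M[K]_n) (a : 'rV[K]_n),
    [/\ g \in unitmx, injective (a 0) & g *m M *m invmx g = diag_mx a].

End LinearAlgebra.

Section Representations.
Variables (K : fieldType) (I : countType) (Q : quiver I).

(* V_i is the space of row vectors 'rV_(d i), on which matrices act from the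
   right: the composite B_{h'} B_h is B h *m B h', and the subspaces of V_i
   are row spaces. *)
Definition rep (d : dimv I) : Type :=
  forall i j, arr Q i j -> 'M[K]_(d i, d j).

(* The coordinate ring of the affine space X_d; only finitely many coordinates
   exist since d has finite support. *)
Inductive polyfun (d : dimv I) : (rep d -> K) -> Prop :=
| polyfun_cst (c : K) : polyfun (fun=> c)
| polyfun_coord i j (h : arr Q i j) a b :
    polyfun (fun B : rep d => B i j h a b)
| polyfun_add p q : polyfun p -> polyfun q -> polyfun (fun B => p B + q B)
| polyfun_mul p q : polyfun p -> polyfun q -> polyfun (fun B => p B * q B).

Definition zclosed d (Z : set (rep d)) : Prop :=
  exists2 S : set (rep d -> K), (forall p, S p -> polyfun p) &
    Z = [set B | forall p, S p -> p B = 0].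

Definition zclosure d (Y : set (rep d)) : set (rep d) :=
  smallest (@zclosed d) Y.

Definition zirreducible d (Y : set (rep d)) : Prop :=
  Y !=set0 /\ forall Z1 Z2, zclosed Z1 -> zclosed Z2 ->
    Y `<=` Z1 `|` Z2 -> Y `<=` Z1 \/ Y `<=` Z2.

Definition irr_component d (N L : set (rep d)) : Prop :=
  [/\ L `<=` N, zirreducible L &
      forall L', zirreducible L' -> L' `<=` N -> L `<=` L' -> L' = L].

Definition mu d (B : rep d) (i : I) : 'M[K]_(d i) :=
  \sum_(j <- finsupp d) \sum_(h : arr Q i j)
    (if inOmega h then 1 else -1) *: (B i j h *m B j i (bar h)).

Definition tdim (d : dimv I) : nat := (\sum_(i <- finsupp d) d i)%N.

Definition complete_flag (d : dimv I) (F : nat -> forall i, 'M[K]_(d i)) :=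
  (forall k i, (F k i <= F k.+1 i)%MS) /\
  (forall k, (k <= tdim d)%N ->
     (\sum_(i <- finsupp d) \rank (F k i))%N = k).

(* An arrow h : i -> j lies outside bar(Omega)^loop iff i != j or h is in
   Omega. *)
Definition flag_compatible d (B : rep d) (F : nat -> forall i, 'M[K]_(d i)) :=
  (forall k i (h : arr Q i i), (k <= tdim d)%N -> ~~ inOmega h ->
     (F k i *m B i i h <= F k i)%MS) /\
  (forall k i j (h : arr Q i j), (k < tdim d)%N -> (i != j) || inOmega h ->
     (F k.+1 i *m B i j h <= F k j)%MS).

Definition N_ d : set (rep d) := [set B |
  [/\ exists2 F, complete_flag F & flag_compatible B F,
      forall i, mu B i = 0 &
      forall i (h : arr Q i i), ~~ inOmega h ->
        regular_semisimple (B i i h)]].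

Definition Irr d : Type := {L : set (rep d) | irr_component (@N_ d) L}.

Definition loop_alg d (B : rep d) (i : I) : set 'M[K]_(d i) :=
  subalg_gen [set B i i h | h in [set: arr Q i i]].
Arguments loop_alg {d} B i.

Definition in_image d (B : rep d) (i : I) : 'M[K]_(d i) :=
  (\sum_(j <- finsupp d | j != i) \sum_(h : arr Q j i) <<B j i h>>)%MS.

Definition W_ d (B : rep d) (i : I) : 'M[K]_(d i) :=
  mx_of_rowspace (lin_span
    [set w *m a | w in rowspace (in_image B i) & a in loop_alg B i]).

Definition eps_rep d (B : rep d) (i : I) : nat := (d i - \rank (W_ B i))%N.

Definition generic_on d (L : set (rep d)) (T : set (rep d)) : Prop :=
  exists Z, [/\ zclosed Z, ~ L `<=` Z & L `\` Z `<=` T].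

(* L is irreducible, so at most one l is generic on it. *)
Definition eps_comp d (i : I) (L : set (rep d)) : nat :=
  xget 0%N [set l | generic_on L [set B | eps_rep B i = l]].

(* B' is isomorphic to the restriction of B to the graded subspace U. *)
Definition iso_restriction d d' (B : rep d) (U : forall j, 'M[K]_(d j))
    (B' : rep d') : Prop :=
  exists g : forall j, 'M[K]_(d' j, d j),
    [/\ forall j, row_free (g j), forall j, (g j :=: U j)%MS &
        forall j k (h : arr Q j k), B' j k h *m g k = g j *m B j k h].

Definition e_pow d (i : I) (l : nat) (L : set (rep d)) :
    set (rep (dimv_sub d i l)) :=
  zclosure [set B' | exists B, [/\ L B, eps_rep B i = l &
    iso_restriction B (fun j => if j == i then W_ B j else 1%:M) B']]
  `&` @N_ (dimv_sub d i l).
Arguments e_pow {d} i l L.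

Definition crys : Type := {d : dimv I & Irr d}.

Definition crys_eps (i : I) (b : crys) : nat :=
  eps_comp i (sval (projT2 b)).

Definition crys_e_pow (i : I) (l : nat) (b : crys) :
    {d : dimv I & set (rep d)} :=
  existT (fun d => set (rep d)) _ (e_pow i l (sval (projT2 b))).

(* The inverse of the bijection e_i^l from {eps_i = l} to {eps_i = 0}, for all
   weights at once; None would only be a default value for X outside its
   image. *)
Definition crys_e_pow_inv (i : I) (l : nat) (X : {d : dimv I & set (rep d)}) :
    option crys :=
  pick_opt (fun b => crys_eps i b = l /\ crys_e_pow i l b = X).

Definition crys_e (i : I) (b : crys) : option crys :=
  if crys_eps i b is l.+1 then crys_e_pow_inv i l (crys_e_pow i l.+1 b)
  else None.

Definition crys_f (i : I) (b : crys) : option crys :=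
  let l := crys_eps i b in crys_e_pow_inv i l.+1 (crys_e_pow i l b).

Definition crys_eps' (i : I) (b : crys) : option int :=
  Some (if cartan Q i i == 2 then (crys_eps i b)%:Z else 0).

Variable D : BC_datum (cartan Q).

Definition crys_wt (b : crys) : wlat D := - root_of D (projT1 b).

Definition crys_phi (i : I) (b : crys) : option int :=
  omap (fun x => coroot D i (crys_wt b) + x) (crys_eps' i b).

End Representations.

Arguments N_ {K I Q} d.
Arguments loop_alg {K I Q d} B i.
Arguments e_pow {K I Q d} i l L.

(* Main.v *)
(* The only axiom of a crystal that is not formal is the equivalence between
   f_i b = b' and e_i b' = b.  It says that a component L of N_d with
   eps_i(L) = l is determined by the closure of the set R of restrictions of
   its generic points B to W_i(B) + sum_(j <> i) V_j.

   Let Y be the set of all B in N_d with eps_i(B) = l whose restriction lies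
   in R.  Y contains a dense part of L, so that L is the closure of Y as soon
   as Y is irreducible.  A point of Y over x in R is given by a splitting of V,
   a representation y of the loops at i on the quotient of dimension l, and a
   solution S of a linear equation nu(x, y, S) = 0; the map nu(x, y, -) is
   surjective because eps_i(x) = 0.  The y in triangular form solve a linear
   equation too: the commutator with a regular semisimple triangular matrix is
   injective, hence surjective, on strictly triangular matrices.  Kernels of
   polynomial families of surjections have polynomial sections, so Y is a tower
   of fibrations with irreducible fibres over R, and R is itself irreducible
   since it is fibred in orbits over L.  The same sections show that the
   closure of Y only depends on the closure of R. *)

From HB Require Import structures.
From mathcomp Require Import all_boot all_order all_algebra.
From mathcomp Require Import separable zify ring.
From mathcomp Require Import finmap boolp classical_sets reals complex.
Require Import Defs.

Set Implicit Arguments.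
Unset Strict Implicit.
Unset Printing Implicit Defensive.

Import GRing.Theory Num.Theory.
Local Open Scope classical_set_scope.
Local Open Scope ring_scope.

(** * Irreducibility over an algebra of functions *)

(** Irreducible fibres over an irreducible base do not by themselves make a total space irreducible.
    What makes them do so here is a section through each point of the total space, over a non-empty
    open part of the base, along which the non-vanishing of a function descends to the base. This is
    why many lemmas take a polynomial that is non-zero at a point and return another polynomial on
    another space. Sections of kernels are built with adjugates and stay polynomial; where inverses
    are unavoidable, rational maps with a controlled denominator are used. The basic irreducible
    sets are those whose points are joined in pairs by rational curves: affine spaces, solution
    spaces, orbits. The line needs an infinite field, the eigenvalue conditions an algebraically
    closed one, and the surjectivity of [nu] a positive Hermitian form; hence [numClosedFieldType],
    specialised to [R[i]] only in the theorem. Once [e_pow] is injective on components with a given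
    generic [eps], the inverse picked by choice is unique, and [f b = b'] and [e b' = b] both unfold
    to the relation [crys_edge]. *)

Section FunctionAlgebras.
Variable K : fieldType.

(** An abstract stand-in for a coordinate ring: the line, the quotient representations and the
    representation spaces then share one notion of irreducibility. *)
Record funalg (T : Type) (A : set (T -> K)) : Prop := FunAlg {
  fa_cst : forall c, A (fun=> c);
  fa_add : forall f g, A f -> A g -> A (fun t => f t + g t);
  fa_mul : forall f g, A f -> A g -> A (fun t => f t * g t) }.

Definition mxin (T : Type) (A : set (T -> K)) m n (M : T -> 'M[K]_(m, n)) :=
  forall a b, A (fun t => M t a b).

Section Closure.
Variables (T : Type) (A : set (T -> K)).
Hypothesis algA : funalg A.

Lemma fa_ext f g : A f -> f =1 g -> A g.
Proof. by move=> Af /funext <-. Qed.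

Lemma fa_sum J (r : seq J) (P : pred J) (F : J -> T -> K) :
  (forall j, P j -> A (F j)) -> A (fun t => \sum_(j <- r | P j) F j t).
Proof.
move=> AF; elim: r => [|j r IHr].
  by apply: fa_ext (fa_cst algA 0) _ => t; rewrite big_nil.
case Pj: (P j); last by apply: fa_ext IHr _ => t; rewrite big_cons Pj.
by apply: fa_ext (fa_add algA (AF j Pj) IHr) _ => t; rewrite big_cons Pj.
Qed.

Lemma fa_prod J (r : seq J) (P : pred J) (F : J -> T -> K) :
  (forall j, P j -> A (F j)) -> A (fun t => \prod_(j <- r | P j) F j t).
Proof.
move=> AF; elim: r => [|j r IHr].
  by apply: fa_ext (fa_cst algA 1) _ => t; rewrite big_nil.
case Pj: (P j); last by apply: fa_ext IHr _ => t; rewrite big_cons Pj.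
by apply: fa_ext (fa_mul algA (AF j Pj) IHr) _ => t; rewrite big_cons Pj.
Qed.

Lemma fa_exp f n : A f -> A (fun t => f t ^+ n).
Proof.
move=> Af; elim: n => [|n IHn]; first exact: fa_cst algA 1.
by apply: fa_ext (fa_mul algA Af IHn) _ => t; rewrite exprS.
Qed.

Lemma fa_scale c f : A f -> A (fun t => c * f t).
Proof. by move=> Af; exact: (fa_mul algA (fa_cst algA c)). Qed.

Lemma fa_opp f : A f -> A (fun t => - f t).
Proof. by move/(fa_scale (-1))/fa_ext; apply=> t; rewrite mulN1r. Qed.

Lemma fa_sub f g : A f -> A g -> A (fun t => f t - g t).
Proof. by move=> Af Ag; exact: (fa_add algA Af (fa_opp Ag)). Qed.

Lemma mxin_cst m n (M : 'M[K]_(m, n)) : mxin A (fun=> M).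
Proof. by move=> a b; exact: fa_cst. Qed.

Lemma mxin_add m n (M N : T -> 'M[K]_(m, n)) :
  mxin A M -> mxin A N -> mxin A (fun t => M t + N t).
Proof.
by move=> AM AN a b; apply: fa_ext (fa_add algA (AM a b) (AN a b)) _ => t;
  rewrite mxE.
Qed.

Lemma mxin_scale m n c (M : T -> 'M[K]_(m, n)) :
  A c -> mxin A M -> mxin A (fun t => c t *: M t).
Proof.
by move=> Ac AM a b; apply: fa_ext (fa_mul algA Ac (AM a b)) _ => t;
  rewrite mxE.
Qed.

Lemma mxin_sub m n (M N : T -> 'M[K]_(m, n)) :
  mxin A M -> mxin A N -> mxin A (fun t => M t - N t).
Proof.
by move=> AM AN a b; apply: fa_ext (fa_sub (AM a b) (AN a b)) _ => t;
  rewrite !mxE.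
Qed.

Lemma mxin_sum m n J (r : seq J) (P : pred J) (M : J -> T -> 'M[K]_(m, n)) :
  (forall j, P j -> mxin A (M j)) ->
  mxin A (fun t => \sum_(j <- r | P j) M j t).
Proof.
move=> AM a b; apply: fa_ext (fa_sum r (fun j Pj => AM j Pj a b)) _ => t.
by rewrite summxE.
Qed.

Lemma mxin_mul m n p (M : T -> 'M[K]_(m, n)) (N : T -> 'M[K]_(n, p)) :
  mxin A M -> mxin A N -> mxin A (fun t => M t *m N t).
Proof.
move=> AM AN a b; apply: fa_ext (fa_sum _ _) _; first last.
- by move=> t; rewrite mxE; apply: eq_bigr => j _.
- by move=> j _; exact: (fa_mul algA (AM a j) (AN j b)).
Qed.

Lemma fa_det n (M : T -> 'M[K]_n) : mxin A M -> A (fun t => \det (M t)).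
Proof.
move=> AM; apply: fa_sum => s _; apply: fa_scale.
by apply: fa_prod => j _; exact: AM.
Qed.

Lemma mxin_adj n (M : T -> 'M[K]_n) : mxin A M -> mxin A (fun t => \adj (M t)).
Proof.
move=> AM a b; apply: (@fa_ext (fun t => cofactor (M t) b a)); last first.
  by move=> t; rewrite mxE.
apply: fa_scale; apply: fa_det => i j.
by apply: fa_ext (AM (lift b i) (lift a j)) _ => t; rewrite !mxE.
Qed.

Lemma mxin_mxvec m n (M : T -> 'M[K]_(m, n)) :
  mxin A M -> mxin A (fun t => mxvec (M t)).
Proof.
move=> AM a b; case/mxvec_indexP: b => i j; rewrite (ord1 a).
by apply: fa_ext (AM i j) _ => t; rewrite mxvecE.
Qed.

End Closure.

(* Irreducibility of [Y] for the topology whose closed sets are the zero sets of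
   functions of the algebra [A]. *)
Definition irr (T : Type) (A : set (T -> K)) (Y : set T) : Prop :=
  forall f g, A f -> A g -> (exists2 y, Y y & f y != 0) ->
    (exists2 y, Y y & g y != 0) -> exists y, [/\ Y y, f y != 0 & g y != 0].

(** Multiplying both test functions by [h] forces their common non-zero point into the open set. *)
Lemma irr_open T (A : set (T -> K)) (Y : set T) h : funalg A -> irr A Y ->
  A h -> irr A [set y | Y y /\ h y != 0].
Proof.
move=> algA irrY Ah f g Af Ag [y1 [Yy1 hy1] fy1] [y2 [Yy2 hy2] gy2].
have [||||y [Yy]] := irrY (fun y => f y * h y) (fun y => g y * h y).
- exact: fa_mul.
- exact: fa_mul.
- by exists y1; rewrite // mulf_neq0.
- by exists y2; rewrite // mulf_neq0.
rewrite !mulf_eq0 !negb_or => /andP[fy hy] /andP[gy _].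
by exists y.
Qed.

(* Irreducibility of a total space: through every point goes a (rational)
   section over an open subset of the irreducible base, and the fibres are
   irreducible. *)
Lemma irr_fibration T T' (A : set (T -> K)) (A' : set (T' -> K)) (X : set T)
    (Y : set T') (over : T -> T' -> Prop) :
    irr A X ->
    (forall f y, A' f -> Y y -> f y != 0 -> exists f', [/\ A f',
       exists2 x, X x & f' x != 0 &
       forall x, X x -> f' x != 0 ->
         exists y', [/\ Y y', over x y' & f y' != 0]]) ->
    (forall x, X x -> irr A' [set y | Y y /\ over x y]) ->
  irr A' Y.
Proof.
move=> irrX sec irrF f g Af Ag [y1 Yy1 fy1] [y2 Yy2 gy2].
have [f' [Af' exf' Pf']] := sec f y1 Af Yy1 fy1.
have [g' [Ag' exg' Pg']] := sec g y2 Ag Yy2 gy2.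
have [x [Xx f'x g'x]] := irrX f' g' Af' Ag' exf' exg'.
have [z1 [Yz1 xz1 fz1]] := Pf' x Xx f'x.
have [z2 [Yz2 xz2 gz2]] := Pg' x Xx g'x.
have [||y [[Yy _] fy gy]] := irrF x Xx f g Af Ag.
- by exists z1.
- by exists z2.
- by exists y.
Qed.

Definition polyK : set (K -> K) := [set f | exists p : {poly K}, forall t,
  f t = p.[t]].

Lemma funalg_polyK : funalg polyK.
Proof.
split=> [c|f g [p fE] [q gE]|f g [p fE] [q gE]].
- by exists c%:P => t; rewrite hornerC.
- by exists (p + q) => t; rewrite hornerD fE gE.
- by exists (p * q) => t; rewrite hornerM fE gE.
Qed.

Lemma polyK_id : polyK id.
Proof. by exists 'X => t; rewrite hornerX. Qed.

(* [g] is a rational map: denominators are powers of [D]. *)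
Definition ratmap T T' (A : set (T -> K)) (D : T -> K) (A' : set (T' -> K))
    (g : T -> T') : Prop :=
  forall f, A' f -> exists n, exists2 c, A c &
    forall t, D t != 0 -> D t ^+ n * f (g t) = c t.

Lemma ratmap_pullback T T' (A : set (T -> K)) D (A' : set (T' -> K)) g f :
  funalg A -> A D -> ratmap A D A' g -> A' f ->
  exists2 c, A c & forall t, (c t != 0) = (D t != 0) && (f (g t) != 0).
Proof.
move=> algA AD rat_g /rat_g[n [c Ac cE]].
(* The extra factor [D t] makes the pulled back function vanish wherever [D] does; nothing is known
   about [g] there. *)
exists (fun t => D t * c t) => [|t]; first exact: fa_mul.
rewrite mulf_eq0 negb_or; case: eqVneq => //= Dt.
by rewrite -cE // mulf_eq0 expf_eq0 (negPf Dt) andbF.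
Qed.

End FunctionAlgebras.

Section Lines.
Variable K : numFieldType.

Lemma irr_polyK : irr (@polyK K) setT.
Proof.
move=> f g [p fE] [q gE] [y1 _ fy1] [y2 _ gy2].
have pq0 : p * q != 0.
  rewrite mulf_neq0 //; first by apply: contraNneq fy1 => p0;
    rewrite fE p0 horner0.
  by apply: contraNneq gy2 => q0; rewrite gE q0 horner0.
(* These integers are distinct in characteristic zero, and there is one more of them than [p * q]
   can have roots. *)
pose s := [seq (n%:R : K) | n <- iota 0 (size (p * q))].
have us : uniq s.
  rewrite map_inj_uniq ?iota_uniq // => m n /eqP.
  by rewrite eqr_nat => /eqP.
have /allPn[t _ nt] : ~~ all (root (p * q)) s.
  apply/negP => /(max_poly_roots pq0) /(_ us).
  by rewrite size_map size_iota ltnn.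
exists t; split=> //; rewrite ?fE ?gE; move: nt; rewrite rootM negb_or;
  by case/andP.
Qed.

(** Two functions, each non-zero at one end of the curve, pull back to non-zero polynomials in one
    variable, which have a common non-zero point. *)
Lemma irr_rat_curve T (A : set (T -> K)) (Y : set T) :
    (forall y1 y2, Y y1 -> Y y2 -> exists (D : K -> K) (g : K -> T),
      [/\ polyK D, ratmap (@polyK K) D A g, D 0 != 0 /\ D 1 != 0,
          g 0 = y1 /\ g 1 = y2 & forall t, D t != 0 -> Y (g t)]) ->
  irr A Y.
Proof.
move=> curve f1 f2 Af1 Af2 [y1 Yy1 fy1] [y2 Yy2 fy2].
have [D [g [AD rat_g [D0 D1] [g0 g1] Yg]]] := curve y1 y2 Yy1 Yy2.
have [c1 Ac1 c1E] := ratmap_pullback (funalg_polyK K) AD rat_g Af1.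
have [c2 Ac2 c2E] := ratmap_pullback (funalg_polyK K) AD rat_g Af2.
have [||t [_]] := irr_polyK Ac1 Ac2.
- by exists 0 => //; rewrite c1E D0 g0.
- by exists 1 => //; rewrite c2E D1 g1.
rewrite c1E c2E => /andP[Dt f1t] /andP[_ f2t].
by exists (g t); split=> //; exact: Yg.
Qed.

End Lines.

(* A kernel of a family of surjective linear maps has polynomial sections
   through each of its points: if [G] is the matrix of [A t] on preimages of a
   basis under [A t0], then [det G * v0 - (A t v0) * adj G] is in the kernel
   of [A t]. *)
Lemma kernel_section (K : fieldType) (T V : Type) (A : set (T -> K)) m n
    (L : T -> V -> 'M[K]_(m, n)) t0 v0 :
    funalg A -> (forall v, mxin A (fun t => L t v)) ->
    L t0 v0 = 0 -> (forall M, exists v, L t0 v = M) ->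
  exists (k : nat) (v : 'I_k.+1 -> V) (c : 'I_k.+1 -> T -> K),
    [/\ forall a, A (c a), v ord0 = v0, forall a, c a t0 = (a == ord0)%:R &
        forall t, \sum_a c a t *: L t (v a) = 0].
Proof.
move=> algA AL L0 surj; pose k := (m * n)%N.
have /choice[w wE] : forall a : 'I_k, exists v, mxvec (L t0 v) = delta_mx 0 a.
  move=> a; have [v vE] := surj (vec_mx (delta_mx 0 a)).
  by exists v; rewrite vE vec_mxK.
pose G t : 'M_k := \matrix_a mxvec (L t (w a)).
have AG : mxin A G.
  move=> a b; apply: fa_ext (mxin_mxvec (AL (w a)) 0 b) _ => t.
  by rewrite [in RHS]mxE.
have G1 : G t0 = 1%:M.
  by apply/row_matrixP => a; rewrite rowK wE row1.
pose r t := mxvec (L t v0) *m \adj (G t).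
have Ar : mxin A r by apply: mxin_mul => //;
  [exact: mxin_mxvec|exact: mxin_adj].
pose v a := if unlift ord0 a is Some b then w b else v0.
pose c (a : 'I_k.+1) t :=
  if unlift ord0 a is Some b then - r t 0 b else \det (G t).
exists k, v, c; split.
- move=> a; rewrite /c; case: (unlift ord0 a) => [b|]; last exact: fa_det.
  exact: fa_opp.
- by rewrite /v unlift_none.
- move=> a; rewrite /c; case: unliftP => [b ->|->].
    by rewrite /r L0 linear0 mul0mx mxE oppr0.
  by rewrite G1 det1 eqxx.
move=> t; apply: (can_inj mxvecK); rewrite linear0 linear_sum big_ord_recl /=.
rewrite /c /v unlift_none linearZ /=.
under eq_bigr => a _ do rewrite liftK linearZ /= scaleNr.
rewrite sumrN; apply/eqP; rewrite subr_eq0; apply/eqP.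
transitivity (r t *m G t); last first.
  by rewrite mulmx_sum_row; apply: eq_bigr => a _; rewrite rowK.
by rewrite /r -mulmxA mul_adj_mx -scalemx1 -scalemxAr mulmx1.
Qed.

(** * Linear algebra *)

Section Subspaces.
Variable K : fieldType.

(** Take a matrix of maximal rank among those with row space inside [S]: a vector of [S] outside its
    row space would increase the rank. *)
Lemma subspace_rowspace n (S : set 'rV[K]_n) : is_subspace S ->
  exists M : 'M[K]_n, rowspace M = S.
Proof.
move=> [S0 SD].
pose P r := `[< exists2 M : 'M[K]_n, rowspace M `<=` S & \rank M = r >].
have exP : exists r, P r.
  exists 0%N; apply/asboolP; exists 0; last exact: mxrank0.
  by move=> v; rewrite /rowspace /= submx0 => /eqP ->.
have ubP r : P r -> (r <= n)%N by move=> /asboolP[M _ <-]; exact: rank_leq_col.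
case: (ex_maxnP exP ubP) => r /asboolP[M MS <-] maxM; exists M.
apply/seteqP; split=> // v Sv; apply: contrapT => /negP nMv.
have : P (\rank (M + v)%MS).
  apply/asboolP; exists (M + v)%MS => // w /sub_addsmxP[[w1 w2] ->] /=.
  rewrite addrC (mx11_scalar w2) mul_scalar_mx; apply: SD => //; apply: MS.
  exact: submxMl.
move/maxM; rewrite leqNgt => /negP; apply; apply: rank_ltmx.
by rewrite /ltmx addsmxSl addsmx_sub submx_refl.
Qed.

Lemma rowspace_mx_of_rowspace n (S : set 'rV[K]_n) : is_subspace S ->
  rowspace (mx_of_rowspace S) = S.
Proof.
by move=> /subspace_rowspace[M MS]; rewrite /mx_of_rowspace;
  case: xgetP => [N _ //|/(_ M)].
Qed.

Lemma mxvec_trace m n (X Y : 'M[K]_(m, n)) :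
  (mxvec X *m (mxvec Y)^T) 0 0 = \tr (X *m Y^T).
Proof.
rewrite mxE (reindex _ (curry_mxvec_bij m n)) /=.
rewrite /mxtrace (eq_bigr (fun i => \sum_j X i j * Y i j)); last first.
  by move=> i _; rewrite mxE; apply: eq_bigr => j _; rewrite mxE.
by rewrite pair_bigA; apply: eq_bigr => -[i j] _ /=; rewrite mxE !mxvecE.
Qed.

(** The trace pairing is perfect; this reduces the surjectivity of a linear map to the computation
    of its annihilator. *)
Lemma subspace_full m n (S : set 'M[K]_(m, n)) : is_subspace S ->
    (forall phi : 'M_(n, m), (forall M, S M -> \tr (M *m phi) = 0) ->
      phi = 0) ->
  forall M, S M.
Proof.
move=> [S0 SD] ortho M.
have [|N NE] := @subspace_rowspace _ [set v | S (vec_mx v)].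
  by split=> [|a u v] /=; rewrite ?linear0 ?linearP //; exact: SD.
have SN X : (mxvec X <= N)%MS = S X :> Prop.
  by rewrite -[RHS]/(S X) -{2}[X]mxvecK;
    rewrite -[S _]/([set v | S (vec_mx v)] _) -NE.
suff fullN : row_full N by rewrite -SN submx_full.
(* Each column of the cokernel, reshaped into a matrix and transposed, annihilates [S]. *)
rewrite -cokermx_eq0; apply/eqP/trmx_inj; rewrite trmx0.
apply/row_matrixP => i; rewrite row0 -[LHS]vec_mxK.
set w := vec_mx _; suff -> : w = 0 by rewrite linear0.
apply: trmx_inj; rewrite trmx0; apply: ortho => X; rewrite -SN submxE => /eqP.
move/(congr1 (fun A : 'rV[K]_(m * n) => A 0 i));
  rewrite [in RHS]mxE -mxvec_trace => <-.
by rewrite vec_mxK !mxE; apply: eq_bigr => k _; rewrite !mxE.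
Qed.

End Subspaces.

Section Frames.
Variable K : fieldType.

(** The rows of [u] complete those of [g] to a basis, and [p], [q] give the coordinates in it. *)
Lemma complete_frame m n l (g : 'M[K]_(m, n)) : row_free g -> n = (m + l)%N ->
  exists (p : 'M_(n, m)) (u : 'M_(l, n)) (q : 'M_(n, l)),
    [/\ g *m p = 1%:M, p *m g + q *m u = 1%:M, g *m q = 0, u *m p = 0 &
        u *m q = 1%:M].
Proof.
move=> fg nE; subst n; pose E := row_ebase g; pose C := col_ebase g.
have uE : E \in unitmx by exact: row_ebase_unit.
have uC : C \in unitmx by exact: col_ebase_unit.
have gE : g = C *m row_mx 1%:M 0 *m E.
  rewrite -{1}[g]mulmx_ebase (eqP fg) -/E -/C; congr (_ *m _ *m _).
  by rewrite pid_mx_row.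
exists (invmx E *m col_mx (invmx C) 0), (row_mx 0 1%:M *m E),
  (invmx E *m col_mx 0 1%:M).
rewrite gE; split.
- rewrite !mulmxA mulmxK // -!mulmxA mul_row_col mul0mx addr0 mul1mx.
  by rewrite mulmxV.
- transitivity (invmx E *m (col_mx (invmx C) 0 *m (C *m row_mx 1%:M 0)
      + col_mx 0 1%:M *m row_mx 0 1%:M) *m E).
    by rewrite mulmxDr mulmxDl !mulmxA.
  rewrite !mul_col_mx !mul0mx mulmxA mulVmx // !mul1mx add_col_mx add0r addr0.
  by rewrite -block_mxEv -scalar_mx_block mulmx1 mulVmx.
- by rewrite !mulmxA mulmxK // -mulmxA mul_row_col mulmx0 mul0mx addr0 mulmx0.
- by rewrite !mulmxA mulmxK // mul_row_col mul0mx mulmx0 addr0.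
- by rewrite !mulmxA mulmxK // mul_row_col mul0mx mulmx1 add0r.
Qed.

End Frames.

(** * Regular semisimple matrices and separable characteristic polynomials *)

Section RegularSemisimple.
Variable K : closedFieldType.

Lemma char_poly_split n (M : 'M[K]_n) :
  exists s, char_poly M = \prod_(x <- s) ('X - x%:P).
Proof.
have [s sE] := closed_field_poly_normal (char_poly M); exists s.
by rewrite sE (monicP (char_poly_monic M)) scale1r.
Qed.

(** Rectangular shapes are allowed because the base change applied next is [col_mx g u], whose
    height [m + l] is not syntactically [n]. *)
Lemma char_poly_conj m n (g : 'M[K]_(m, n)) p (M : 'M_n) :
  g *m p = 1%:M -> p *m g = 1%:M -> char_poly (g *m M *m p) = char_poly M.
Proof.
move=> gp pg; have e : m = n.
  by apply/eqP; rewrite eqn_leq (mulmx1_min gp) (mulmx1_min pg).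
subst m; rewrite /char_poly.
have <- : map_mx polyC g *m char_poly_mx M *m map_mx polyC p =
    char_poly_mx (g *m M *m p).
  rewrite /char_poly_mx mulmxBr mulmxBl !map_mxM; congr (_ - _).
  by rewrite scalar_mxC -mulmxA -map_mxM gp map_mx1 mulmx1.
rewrite !det_mulmx mulrAC -det_mulmx -map_mxM gp.
by rewrite map_mx1 det1 mul1r.
Qed.

(** In the basis formed by [g] and [u], the matrix [B] is block triangular with diagonal blocks [x]
    and [u *m B *m q]. *)
Lemma char_poly_frame m n l (g : 'M[K]_(m, n)) p (u : 'M_(l, n)) q
    (B : 'M_n) x :
    g *m p = 1%:M -> p *m g + q *m u = 1%:M -> g *m q = 0 -> u *m p = 0 ->
    u *m q = 1%:M -> g *m B = x *m g ->
  char_poly B = char_poly x * char_poly (u *m B *m q).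
Proof.
move=> gp pgqu gq up uq gB.
rewrite -(@char_poly_conj _ _ (col_mx g u) (row_mx p q) B); first last.
- by rewrite mul_row_col.
- by rewrite mul_col_row gp gq up uq -scalar_mx_block.
rewrite mul_col_mx gB mul_col_row -!(mulmxA x) gp gq mulmx1 mulmx0.
rewrite /char_poly -(det_lblock (char_poly_mx x) (- map_mx polyC (u *m B *m
  p))).
congr (\det _); rewrite /char_poly_mx map_block_mx (scalar_mx_block m l).
by rewrite opp_block_mx add_block_mx !add0r map_mx0 oppr0.
Qed.

(** A product is separable when its factors are separable and coprime, so in this form the condition
    splits along block triangular matrices. *)
Lemma regular_semisimpleP n (M : 'M[K]_n) :
  regular_semisimple M <-> separable_poly (char_poly M).
Proof.
split=> [[g [a [ug inja gM]]]|].
  have -> : char_poly M = char_poly (diag_mx a).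
    by rewrite -gM char_poly_conj // (mulmxV, mulVmx).
  rewrite char_poly_trig ?diag_mx_is_trig //.
  under eq_bigr => i _ do rewrite mxE eqxx mulr1n.
  rewrite -(big_map _ predT (fun x => 'X - x%:P)) separable_prod_XsubC.
  by rewrite map_inj_uniq // /index_enum -enumT enum_uniq.
move=> sepM; case: n M sepM => [|n] M sepM.
  by exists 1%:M, 0; split; [exact: unitmx1 | case | rewrite !flatmx0].
have [s sE] := char_poly_split M.
have us : uniq s by rewrite -separable_prod_XsubC -sE.
have /diagonalizableP : exists2 rs,
  uniq rs & mxminpoly M %| \prod_(x <- rs) ('X - x%:P).
  by exists s => //; rewrite -sE mxminpoly_dvd_char.
move=> [P uP /diagonalizable_forPex[d]].
move=> dE; have {}dE : P *m M *m invmx P = diag_mx d.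
  by rewrite -(conjumx M uP); apply/eqP; exact: dE.
exists P, d; split=> //.
have : separable_poly (char_poly (diag_mx d)).
  by rewrite -dE char_poly_conj // (mulmxV, mulVmx).
rewrite char_poly_trig ?diag_mx_is_trig //.
under eq_bigr => i _ do rewrite mxE eqxx mulr1n.
rewrite -(big_map _ predT (fun x => 'X - x%:P)) separable_prod_XsubC.
by rewrite /index_enum -enumT => /injectiveP.
Qed.

Lemma regular_semisimple_trig n (M : 'M[K]_n) : is_trig_mx M ->
  regular_semisimple M <-> injective (fun a => M a a).
Proof.
move=> trigM; rewrite regular_semisimpleP char_poly_trig //.
rewrite -(big_map (fun a => M a a) predT (fun x => 'X - x%:P)).
rewrite separable_prod_XsubC /index_enum -enumT.
by split=> [/injectiveP|/injectiveP].
Qed.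

(** The determinants express that no diagonal entry of the triangular [y] is an eigenvalue of [x],
    which is coprimality of the two characteristic polynomials. *)
Lemma regular_semisimple_frame m n l (g : 'M[K]_(m, n)) p (u : 'M_(l, n)) q
    (B : 'M_n) x (y := u *m B *m q) :
    g *m p = 1%:M -> p *m g + q *m u = 1%:M -> g *m q = 0 -> u *m p = 0 ->
    u *m q = 1%:M -> g *m B = x *m g -> is_trig_mx y ->
  regular_semisimple B <->
  [/\ regular_semisimple x, injective (fun a => y a a) &
      forall a, \det (x - (y a a)%:M) != 0].
Proof.
move=> gp pgqu gq up uq gB trigy.
have [yP yP'] := regular_semisimple_trig trigy.
have [ssy ssy'] := regular_semisimpleP y.
have [ssx ssx'] := regular_semisimpleP x.
apply: (iff_trans (regular_semisimpleP B)).
rewrite (char_poly_frame gp pgqu gq up uq gB) -/y separable_mul.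
have rootE a : (\det (x - (y a a)%:M) != 0) = ~~ root (char_poly x) (y a a).
  rewrite -eigenvalue_root_char /eigenvalue /eigenspace negbK kermx_eq0.
  by rewrite row_free_unit unitmxE unitfE.
have coE : coprimep (char_poly x) (char_poly y) <->
    forall a, \det (x - (y a a)%:M) != 0.
  rewrite (char_poly_trig trigy).
  apply: (@iff_trans _ {in index_enum 'I_l, forall a,
    ~~ root (char_poly x) (y a a)}).
    2: by split=> H a => [|_]; rewrite ?rootE ?H ?mem_index_enum // -rootE.
  elim: (index_enum _) => [|a r IHr]; first by rewrite big_nil coprimep1; split.
  rewrite big_cons coprimepMr coprimep_XsubC.
  split=> [/andP[ra /IHr rr] b|H].
    by rewrite inE => /predU1P[->|/rr].
  rewrite H ?mem_head //=; apply/IHr => b rb.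
  by apply: H; rewrite inE rb orbT.
split=> [/and3P[/ssx' sx /ssy' /yP sy /coE]|[/ssx sx /yP'/ssy sy /coE co]] //.
exact/and3P.
Qed.

Lemma regular_semisimple_sub m n (g : 'M[K]_(m, n)) (B : 'M_n) x :
  row_free g -> g *m B = x *m g -> regular_semisimple B -> regular_semisimple x.
Proof.
move=> fg gB; have le_mn : (m <= n)%N by rewrite -(eqP fg) rank_leq_col.
have [p [u [q [gp pgqu gq up uq]]]] := complete_frame fg (esym (subnKC le_mn)).
move=> /regular_semisimpleP; rewrite (char_poly_frame gp pgqu gq up uq gB).
by rewrite separable_mul => /and3P[/regular_semisimpleP].
Qed.

End RegularSemisimple.

(** * Ranks along flags and adapted bases *)

Section WeakFlags.
Variable K : fieldType.

(** The jumps of a flag do not grow under a linear map, by rank-nullity and monotonicity of the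
    kernel part. The next lemma is the same for intersections with a subspace. *)
Lemma rank_incr_mul m1 m2 n p (A : 'M[K]_(m1, n)) (B : 'M_(m2, n)) (M : 'M_(n,
  p)) :
  (A <= B)%MS -> (\rank (B *m M) + \rank A <= \rank B + \rank (A *m M))%N.
Proof.
move=> sAB; rewrite -(mxrank_mul_ker A M) -(mxrank_mul_ker B M).
rewrite [leqRHS]addnC addnCA !leq_add2l.
by apply: mxrankS; rewrite capmxS.
Qed.

Lemma rank_incr_cap m1 m2 n p (A : 'M[K]_(m1, n)) (B : 'M_(m2, n)) (W : 'M_(p,
  n)) :
  (A <= B)%MS ->
  (\rank (B :&: W)%MS + \rank A <= \rank B + \rank (A :&: W)%MS)%N.
Proof.
move=> sAB; have kerW : (kermx (cokermx W) :=: W)%MS.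
  apply/eqmxP/andP; split; last by rewrite sub_kermx -submxE.
  by rewrite submxE mulmx_ker.
have rankE k (C : 'M_(k, n)) :
    (\rank (C *m cokermx W) + \rank (C :&: W)%MS)%N = \rank C.
  by rewrite -[RHS](mxrank_mul_ker C (cokermx W)) (cap_eqmx (eqmx_refl C) kerW).
rewrite -(rankE _ A) -(rankE _ B) addnCA addnA leq_add2r leq_add2r.
by apply: mxrankS; rewrite submxMr.
Qed.

Lemma row_pid_mx l k (i : 'I_l) :
  row i (pid_mx k : 'M[K]_l) = (i < k)%:R *: delta_mx 0 i.
Proof. by apply/rowP => j; rewrite !mxE eqxx /= (eq_sym j) -natrM mulnb andbC.
  Qed.

(* Choosing a vector at each step where the flag jumps gives a basis whose
   first [\rank (F k)] vectors span [F k]. *)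
Lemma flag_basis l (F : nat -> 'M[K]_l) m :
    F 0%N = 0 -> (forall k, (F k <= F k.+1)%MS) ->
    (forall k, (\rank (F k.+1) <= (\rank (F k)).+1)%N) -> row_full (F m) ->
  exists2 P : 'M_l, P \in unitmx &
    forall k, (k <= m)%N -> (F k :=: (pid_mx (\rank (F k)) : 'M_l) *m P)%MS.
Proof.
move=> F0 Fmono Fstep Fm.
have mono k1 k2 : (k1 <= k2)%N -> (F k1 <= F k2)%MS.
  by move=> /subnKC <-; elim: (k2 - k1)%N => [|j IH];
    rewrite ?addn0 // addnS (submx_trans IH).
suff [P PE] : exists P : 'M_l,
    forall k, (k <= m)%N -> (F k :=: (pid_mx (\rank (F k)) : 'M_l) *m P)%MS.
  exists P => //; rewrite -row_full_unit -sub1mx.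
  apply: submx_trans (submxMl (pid_mx (\rank (F m)) : 'M_l) P).
  by rewrite -(PE m (leqnn m)) sub1mx.
elim: m {Fm} => [|m [P PE]].
  by exists 0 => k; rewrite leqn0 => /eqP ->; rewrite F0 mulmx0.
have [rE|rN] := eqVneq (\rank (F m.+1)) (\rank (F m)).
  exists P => k; rewrite leq_eqVlt => /predU1P[->|]; last exact: PE.
  have eqF : (F m.+1 :=: F m)%MS.
    by apply/eqmxP; rewrite Fmono -(mxrank_leqif_sup (Fmono m)) rE eqxx.
  by apply: eqmx_trans eqF _; rewrite rE; exact: PE.
set r := \rank (F m).
have rS : \rank (F m.+1) = r.+1.
  apply/eqP; rewrite eqn_leq Fstep ltn_neqAle eq_sym rN.
  exact: mxrankS (Fmono m).
have rl : (r < l)%N by rewrite -rS rank_leq_col.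
have [v vF vN] : exists2 v : 'rV_l, (v <= F m.+1)%MS & ~~ (v <= F m)%MS.
  have /row_subPn[i iN] : ~~ (F m.+1 <= F m)%MS.
    by apply: contra_neqN rN => s; apply/eqP;
      rewrite eqn_leq mxrankS // mxrankS.
  by exists (row i (F m.+1)); rewrite ?row_sub.
pose P' : 'M_l := \matrix_i (if i == r :> nat then v else row i P).
have pidE k : (k <= r)%N -> (pid_mx k : 'M_l) *m P' = (pid_mx k : 'M_l) *m P.
  move=> kr; apply/row_matrixP => i; rewrite !row_mul row_pid_mx.
  rewrite -!scalemxAl -!rowE rowK.
  by case: ltnP => // ik; rewrite ?scale0r // ltn_eqF // (leq_trans ik).
exists P' => k; rewrite leq_eqVlt => /predU1P[->|km]; last first.
  by rewrite pidE; [exact: PE | exact: mxrankS (mono _ _ _)].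
apply/eqmx_sym/eqmxP; rewrite rS.
have pidS : ((pid_mx r.+1 : 'M_l) *m P' <= F m.+1)%MS.
  apply/row_subP => i; rewrite row_mul row_pid_mx -scalemxAl -rowE rowK.
  case: eqP => [_|/eqP ir]; first exact: scalemx_sub.
  case: (ltnP i r.+1) => [|_]; last by rewrite scale0r sub0mx.
  rewrite ltnS leq_eqVlt (negPf ir) /= => lt_ir; rewrite scale1r.
  apply: submx_trans (Fmono m); rewrite (PE m) // -/r.
  have -> : row i P = row i ((pid_mx r : 'M_l) *m P).
    by rewrite row_mul row_pid_mx lt_ir scale1r -rowE.
  exact: row_sub.
rewrite pidS /= -(mxrank_leqif_sup pidS) eqn_leq mxrankS //= rS.
have sF : (F m <= (pid_mx r.+1 : 'M_l) *m P')%MS.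
  rewrite (PE m) // -/r -pidE //.
  have -> : (pid_mx r : 'M[K]_l) = (pid_mx r : 'M_l) *m (pid_mx r.+1 : 'M_l).
    by rewrite mul_pid_mx (minn_idPl (leqnSn r)) (minn_idPr (ltnW rl)).
  by rewrite -mulmxA submxMl.
apply: rank_ltmx; rewrite /ltmx sF /=.
apply: contra vN; apply: submx_trans.
have -> : v = row (Ordinal rl) ((pid_mx r.+1 : 'M_l) *m P').
  by rewrite row_mul row_pid_mx ltnSn scale1r -rowE rowK eqxx.
exact: row_sub.
Qed.

End WeakFlags.

(** * Commutators of triangular with strictly triangular matrices *)

Section StrictTriangular.
Variables (K : fieldType) (l : nat).
Implicit Types s y : 'M[K]_l.

(** Lower triangular, like [is_trig_mx]: with row vectors, the span of the first basis vectors is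
    preserved, and here it is pushed one step down. *)
Definition strict_trig s : Prop := forall a b : 'I_l, (a <= b)%N -> s a b = 0.

Definition strict_part s : 'M[K]_l :=
  \matrix_(a, b) (if (b < a)%N then s a b else 0).

Lemma strict_part_linear : linear strict_part.
Proof.
by move=> c s t; apply/matrixP => a b; rewrite !mxE; case: ifP;
  rewrite ?mulr0 ?addr0.
Qed.
HB.instance Definition _ := GRing.isLinear.Build K 'M[K]_l 'M[K]_l _ strict_part
  strict_part_linear.

Lemma strict_partP s : strict_trig (strict_part s).
Proof. by move=> a b; rewrite mxE leqNgt => /negPf ->. Qed.

Lemma strict_part_id s : strict_trig s -> strict_part s = s.
Proof.
move=> ss; apply/matrixP => a b; rewrite mxE; case: ltnP => // ab.
by rewrite ss.
Qed.

Lemma strict_trig_mull s y : strict_trig s -> is_trig_mx y ->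
  strict_trig (s *m y).
Proof.
move=> ss /is_trig_mxP ty a b ab; rewrite mxE big1 // => c _.
case: (leqP a c) => ac; first by rewrite ss // mul0r.
by rewrite ty ?mulr0 // (leq_trans ac).
Qed.

Lemma strict_trig_mulr s y : strict_trig s -> is_trig_mx y ->
  strict_trig (y *m s).
Proof.
move=> ss /is_trig_mxP ty a b ab; rewrite mxE big1 // => c _.
case: (ltnP a c) => ac; first by rewrite ty // mul0r.
by rewrite ss ?mulr0 // (leq_trans ac).
Qed.

Lemma strict_trigB s t : strict_trig s -> strict_trig t -> strict_trig (s - t).
Proof. by move=> ss st a b ab; rewrite !mxE ss // st // subr0. Qed.

(** Below the diagonal, entry [a b] of the commutator is a non-zero multiple of [s a b] plus terms
    in entries of [s] nearer to the diagonal; the induction is on [a - b]. *)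
Lemma commuting_strict_trig0 s y : is_trig_mx y -> injective (fun a => y a a) ->
  strict_trig s -> s *m y = y *m s -> s = 0.
Proof.
move=> /is_trig_mxP ty inj_y ss sy.
suff H k (a b : 'I_l) : (a - b <= k)%N -> s a b = 0.
  by apply/matrixP => a b; rewrite mxE (H a a b) // leq_subr.
elim: k a b => [|k IHk] a b ab.
  by rewrite ss // -subn_eq0 -leqn0.
case: (leqP a b) => [/ss//|ba].
move: sy => /matrixP/(_ a b); rewrite !mxE (bigD1 b) //= [RHS](bigD1 a) //=.
rewrite big1 => [|c cb]; last first.
  case: (ltnP c b) => [/ty ->|]; rewrite ?mulr0 //.
  move: cb; rewrite -val_eqE /= => cb bc; rewrite IHk ?mul0r //; lia.
rewrite big1 => [|c ca]; last first.
  case: (ltnP a c) => [/ty ->|]; rewrite ?mul0r //.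
  move: ca; rewrite -val_eqE /= => ca ca'; rewrite IHk ?mulr0 //; lia.
rewrite !addr0 mulrC => /eqP; rewrite -subr_eq0 -mulrBl mulf_eq0 subr_eq0.
by case/orP => /eqP // /inj_y ba'; rewrite ba' ltnn in ba.
Qed.

(** The commutator with [y] on strictly triangular matrices, completed by the identity on the other
    entries. It is an endomorphism of the whole matrix space, so that injectivity gives
    surjectivity. *)
Definition ad_strict y s : 'M[K]_l :=
  strict_part s *m y - y *m strict_part s + (s - strict_part s).

Lemma ad_strict_linear y : linear (ad_strict y).
Proof.
move=> c s t; rewrite /ad_strict strict_part_linear.
rewrite mulmxDl mulmxDr -scalemxAl -scalemxAr.
set A1 := _ *m y; set A2 := _ *m y; set B1 := y *m _; set B2 := y *m _.
by apply/matrixP => i j; rewrite !mxE; ring.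
Qed.
HB.instance Definition _ y := GRing.isLinear.Build K 'M[K]_l 'M[K]_l _
  (ad_strict y)
  (ad_strict_linear y).

Lemma ad_strict_surj y N : is_trig_mx y -> injective (fun a => y a a) ->
  exists s, ad_strict y s = N.
Proof.
move=> ty inj_y; suff uL : lin_mx (ad_strict y) \in unitmx.
  exists (vec_mx (mxvec N *m invmx (lin_mx (ad_strict y)))).
  by apply: (can_inj mxvecK); rewrite -mul_vec_lin vec_mxK mulmxKV.
rewrite -row_free_unit -kermx_eq0; apply/eqP/row_matrixP => i; rewrite row0.
have : row i (kermx (lin_mx (ad_strict y))) *m lin_mx (ad_strict y) = 0.
  by rewrite -row_mul mulmx_ker row0.
move: (row _ _) => v; rewrite -[v]vec_mxK mul_vec_lin => /eqP.
rewrite mxvec_eq0 => /eqP; move: (vec_mx v) => s {v} sE0.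
have sE : strict_part s *m y - y *m strict_part s + (s - strict_part s) = 0.
  exact: sE0.
have sc : strict_trig (strict_part s *m y - y *m strict_part s).
  by apply: strict_trigB; [apply: strict_trig_mull | apply: strict_trig_mulr]
    => //;
    exact: strict_partP.
have s0 : s = strict_part s.
  move: (_ - y *m _) sc sE => ad sc /matrixP sE.
  apply/matrixP => a b; move: (sE a b); rewrite !mxE.
  by case: (ltnP b a) => // ab; rewrite sc // add0r subr0.
move: sE; rewrite -s0 subrr addr0 => /eqP; rewrite subr_eq0 => /eqP sy.
rewrite (commuting_strict_trig0 ty inj_y _ sy) ?linear0 //.
by rewrite s0; exact: strict_partP.
Qed.

End StrictTriangular.

Section TraceForm.
Variable K : numClosedFieldType.

Lemma trace_conj_ge0 m n (M : 'M[K]_(m,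
  n)) : 0 <= \tr ((map_mx Num.conj M)^T *m M).
Proof.
apply: sumr_ge0 => j _; rewrite mxE; apply: sumr_ge0 => k _.
by rewrite !mxE mulrC mul_conjC_ge0.
Qed.

Lemma trace_conj_eq0 m n (M : 'M[K]_(m, n)) :
  \tr ((map_mx Num.conj M)^T *m M) = 0 -> M = 0.
Proof.
have ge0 j k : 0 <= (map_mx Num.conj M)^T j k * M k j.
  by rewrite !mxE mulrC mul_conjC_ge0.
move=> trM; apply/matrixP => k j; rewrite mxE.
have /eqP := trM; rewrite psumr_eq0; last first.
  by move=> i _; rewrite mxE; apply: sumr_ge0.
move=> /allP/(_ j (mem_index_enum _)) /=; rewrite mxE psumr_eq0 //.
move=> /allP/(_ k (mem_index_enum _)) /=.
by rewrite !mxE mulrC mul_conjC_eq0 => /eqP.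
Qed.

End TraceForm.

(** * The subspace W, splittings and flags *)

Section SpaceW.
Variables (K : fieldType) (I : countType) (Q : quiver I).

Lemma dimv_gt0 (d : dimv I) j (a : 'I_(d j)) : j \in finsupp d.
Proof. by rewrite mem_finsupp -lt0n (leq_ltn_trans _ (ltn_ord a)). Qed.

Lemma lin_span_subspace (V : lmodType K) (S : set V) : is_subspace (lin_span S).
Proof.
split=> [A [[]]//|a u v uS vS A [subA SA]].
by case: (subA) => _; apply; [exact: uS|exact: vS].
Qed.

Lemma subalg_gen_subalg n (S : set 'M[K]_n) : is_unital_subalg (subalg_gen S).
Proof.
split.
- split=> [A [[[]]]//|a u v uS vS A [subA SA]].
  by case: (subA) => -[_ AD] _ _; apply: AD; [exact: uS|exact: vS].
- by move=> A [[]].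
- move=> a b aS bS A [subA SA].
  by case: (subA) => _ _; apply; [exact: aS|exact: bS].
Qed.

Lemma funalg_polyfun d : funalg (@polyfun K I Q d).
Proof.
by split=> [c|f g|f g]; [exact: polyfun_cst|exact: polyfun_add|exact:
  polyfun_mul].
Qed.

Variable d : dimv I.
Implicit Types B : rep K Q d.

Lemma sub_in_image B i j (h : arr Q j i) : j != i ->
  (B j i h <= in_image B i)%MS.
Proof.
move=> ji; apply/row_subP => a; apply: submx_trans (row_sub a _) _.
have jd := dimv_gt0 a.
rewrite /in_image (big_rem j) //= ji.
apply: submx_trans (addsmxSl _ _).
by rewrite (sumsmx_sup h) // genmxE.
Qed.

Lemma in_image_min B i m (M : 'M_(m, d i)) :
  (forall j (h : arr Q j i), j != i -> (B j i h <= M)%MS) ->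
  (in_image B i <= M)%MS.
Proof.
move=> BM; rewrite /in_image.
elim/big_ind: _ => [|X Y XM YM|j ji].
- exact: sub0mx.
- by rewrite addsmx_sub XM.
- by apply/sumsmx_subP => h _; rewrite genmxE BM.
Qed.

Lemma sub_W B i (v : 'rV_(d i)) :
  (v <= W_ B i)%MS = lin_span
    [set w *m a | w in rowspace (in_image B i) & a in loop_alg B i] v :> Prop.
Proof.
rewrite -[LHS]/(rowspace (W_ B i) v) /W_ rowspace_mx_of_rowspace //.
exact: lin_span_subspace.
Qed.

Lemma in_image_W B i : (in_image B i <= W_ B i)%MS.
Proof.
apply/rV_subP => v vB; rewrite sub_W => S [_]; apply.
exists v => //; exists 1%:M; last by rewrite mulmx1.
by have [_ ? _] := subalg_gen_subalg [set B i i h | h in [set: arr Q i i]].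
Qed.

Lemma W_loop B i (h : arr Q i i) : (W_ B i *m B i i h <= W_ B i)%MS.
Proof.
apply/rV_subP => _ /submxP[c ->]; rewrite mulmxA.
have : (c *m W_ B i <= W_ B i)%MS by exact: submxMl.
move: (c *m _) => v; rewrite !sub_W => vW.
have [S0 SD] := lin_span_subspace
  [set w *m a | w in rowspace (in_image B i) & a in loop_alg B i].
apply: (vW [set v | lin_span _ (v *m B i i h)]); split.
  split=> [|a u w] /=; first by rewrite mul0mx.
  by rewrite mulmxDl -scalemxAl; exact: SD.
move=> _ [w wB [a aB <-]] /= S [_]; apply.
exists w => //; exists (a *m B i i h); last by rewrite mulmxA.
have [_ _ alg_mul] := subalg_gen_subalg [set B i i h | h in [set: arr Q i i]].
by apply: alg_mul => // T [_]; apply; exists h.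
Qed.

Lemma W_min B i m (M : 'M_(m, d i)) : (in_image B i <= M)%MS ->
  (forall h : arr Q i i, (M *m B i i h <= M)%MS) -> (W_ B i <= M)%MS.
Proof.
move=> BM loopM; apply/rV_subP => v; rewrite sub_W => vW.
apply: (vW [set v | (v <= M)%MS]); split.
  split=> [|a u w uM wM]; rewrite /= ?sub0mx //.
  by rewrite addmx_sub // scalemx_sub.
move=> _ [w wB [a aB <-]] /=.
suff aM : (M *m a <= M)%MS.
  by apply: submx_trans aM; rewrite submxMr // (submx_trans wB).
apply: (aB [set a | (M *m a <= M)%MS]); split.
  split=> [||b c bM cM] /=.
  - split=> [|e b c bM cM] /=; first by rewrite mulmx0 sub0mx.
    by rewrite mulmxDr -scalemxAr addmx_sub // scalemx_sub.
  - by rewrite mulmx1.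
  - by rewrite mulmxA (submx_trans _ cM) // submxMr.
by move=> _ [h _ <-] /=.
Qed.

(** The vectors through which such a polynomial family passes form a subspace that contains the
    images of the arrows into [i] and is stable under the loops, so it contains [W_ B i]. This
    yields the semicontinuity of the rank of [W_] and polynomial local bases of it. *)
Lemma W_section B i (v : 'rV_(d i)) : (v <= W_ B i)%MS ->
  exists w : rep K Q d -> 'rV_(d i),
    [/\ mxin (@polyfun K I Q d) w, forall B', (w B' <= W_ B' i)%MS & w B = v].
Proof.
have algP := funalg_polyfun d.
have [|N NE] := @subspace_rowspace K _ [set v | exists w : rep K Q d ->
  'rV_(d i),
    [/\ mxin (@polyfun K I Q d) w, forall B', (w B' <= W_ B' i)%MS & w B = v]].
  split=> [|a _ _ [u [Pu Wu <-]] [w [Pw Ww <-]]].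
    by exists (fun=> 0); split=> //; [exact: mxin_cst | move=> B';
      rewrite sub0mx].
  exists (fun B' => a *: u B' + w B'); split=> // [|B'].
    by apply: mxin_add => //; apply: mxin_scale => //; exact: fa_cst.
  by rewrite addmx_sub // scalemx_sub.
have NP u : (u <= N)%MS -> exists w : rep K Q d -> 'rV_(d i),
    [/\ mxin (@polyfun K I Q d) w, forall B', (w B' <= W_ B' i)%MS & w B = u].
  by move=> uN; have : rowspace N u by []; rewrite NE.
have PN (u : 'rV_(d i)) (w : rep K Q d ->
  'rV_(d i)) : mxin (@polyfun K I Q d) w -> (forall B', (w B' <= W_ B' i)%MS) ->
    w B = u -> (u <= N)%MS.
  move=> Pw Ww wB; have : rowspace N u by rewrite NE; exists w.
  by [].
move=> vW; apply: (NP); apply: submx_trans vW _; apply: W_min.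
  apply: in_image_min => j h ji; apply/row_subP => a.
  apply: (PN _ (fun B' => row a (B' j i h))) => //.
    move=> b c; rewrite (_ : (fun _ => _) = (fun B' : rep K Q d => B' j i h a
      c)).
      exact: polyfun_coord.
    by apply/funext => B'; rewrite mxE.
  move=> B'; apply: submx_trans (in_image_W B' i).
  by apply: submx_trans (sub_in_image B' h ji); exact: row_sub.
move=> h; apply/rV_subP => _ /submxP[c ->]; rewrite mulmxA.
have /NP[w [Pw Ww <-]] : (c *m N <= N)%MS by exact: submxMl.
apply: (PN _ (fun B' => w B' *m B' i i h)) => //.
  by apply: mxin_mul => // a b; exact: polyfun_coord.
by move=> B'; apply: submx_trans (W_loop B' h); rewrite submxMr.
Qed.

End SpaceW.

Lemma rep_ext (K : fieldType) (I : countType) (Q : quiver I) (d : dimv I)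
    (B B' : rep K Q d) :
  (forall i j (h : arr Q i j), B i j h = B' i j h) -> B = B'.
Proof. by move=> eqB; do 3!apply: functional_extensionality_dep => ?;
  exact: eqB. Qed.

(** * Representations in block triangular form and their moment map *)

Section Form.
Variables (K : fieldType) (I : countType) (Q : quiver I).
Variables (d d' : dimv I) (i : I) (l : nat).

(* A graded splitting of [V] into a copy of [V'] (embedded by [fg]) and a
   complement of dimension [l] at the vertex [i] (embedded by [fu]). *)
Record frame := Frame {
  fp : forall j, 'M[K]_(d j, d' j);
  fg : forall j, 'M[K]_(d' j, d j);
  fu : forall j, 'M[K]_(l, d j);
  fq : forall j, 'M[K]_(d j, l);
  fgp : forall j, fg j *m fp j = 1%:M;
  fpgqu : forall j, fp j *m fg j + fq j *m fu j = 1%:M;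
  fgq : forall j, fg j *m fq j = 0;
  fup : forall j, fu j *m fp j = 0;
  fuq : forall j, fu j *m fq j = (j == i)%:R%:M;
  fq0 : forall j, j != i -> fq j = 0;
  fu0 : forall j, j != i -> fu j = 0 }.

Lemma fuq1 (fr : frame) : fu fr i *m fq fr i = 1%:M.
Proof. by rewrite fuq eqxx. Qed.

(** Indexed by all arrows, to avoid casts along equalities with [i]; since [fq] and [fu] vanish away
    from [i], [form] sees only the relevant entries. *)
Definition quotrep := forall j k, arr Q j k -> 'M[K]_l.
Definition mixrep := forall j k, arr Q j k -> 'M[K]_(l, d' k).

Definition sg j k (h : arr Q j k) : K := if inOmega h then 1 else - 1.

Lemma sg_bar j k (h : arr Q j k) : sg (bar h) = - sg h.
Proof. by rewrite /sg Omega_bar; case: (inOmega h); rewrite ?opprK. Qed.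

(** The extension with subrepresentation [x], quotient [y] and off-diagonal block [S]; [form_unique]
    shows that every representation that preserves the image of [fg] has this shape. *)
Definition form (fr : frame) (x : rep K Q d') (y : quotrep) (S : mixrep) :
    rep K Q d := fun j k h =>
  fp fr j *m x j k h *m fg fr k +
  fq fr j *m (S j k h *m fg fr k + y j k h *m fu fr k).

Section FormTheory.
Variables (fr : frame) (x : rep K Q d') (y : quotrep) (S : mixrep).
Local Notation p := (fp fr).
Local Notation g := (fg fr).
Local Notation u := (fu fr).
Local Notation q := (fq fr).

Lemma g_form j k (h : arr Q j k) : g j *m form fr x y S h = x h *m g k.
Proof. by rewrite /form mulmxDr !mulmxA fgp fgq mul1mx mul0mx addr0. Qed.

Lemma u_form j k (h : arr Q j k) :
  u j *m form fr x y S h = (j == i)%:R *: (S h *m g k + y h *m u k).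
Proof. by rewrite /form mulmxDr !mulmxA fup fuq !mul0mx add0r mul_scalar_mx.
  Qed.

Lemma form_p j k (h : arr Q j k) :
  form fr x y S h *m p k = p j *m x h + q j *m S h.
Proof.
by rewrite /form mulmxDl -!mulmxA mulmxDl -!mulmxA fgp fup !mulmx0 !mulmx1
  addr0.
Qed.

End FormTheory.

Lemma form_unique fr (x : rep K Q d') (B : rep K Q d) :
  (forall j k (h : arr Q j k), fg fr j *m B j k h = x j k h *m fg fr k) ->
  B = form fr x (fun j k h => fu fr j *m B j k h *m fq fr k)
                (fun j k h => fu fr j *m B j k h *m fp fr k).
Proof.
move=> gB; apply: rep_ext => j k h; rewrite /form.
rewrite -!mulmxA -!mulmxDr fpgqu mulmx1 -gB !mulmxA -mulmxDl fpgqu.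
by rewrite mul1mx.
Qed.

Hypothesis dE : forall j, d j = (d' j + (if j == i then l else 0))%N.

Lemma frame_exists (g : forall j, 'M[K]_(d' j, d j)) :
  (forall j, row_free (g j)) -> exists fr, fg fr = g.
Proof.
move=> freeg.
have H j : exists m : 'M_(d j, d' j) * 'M_(l, d j) * 'M_(d j, l),
    let: (p, u, q) := m in
    [/\ g j *m p = 1%:M, p *m g j + q *m u = 1%:M, g j *m q = 0, u *m p = 0 &
      u *m q = (j == i)%:R%:M] /\ (j != i -> q = 0 /\ u = 0).
  case: (eqVneq j i) (dE j) => ji dj.
    have [p [u [q [gp pgqu gq up uq]]]] := complete_frame (freeg j) dj.
    by exists (p, u, q).
  have [p [u [q [gp pgqu _ _ _]]]] := complete_frame (freeg j) dj.
  exists (p, 0, 0); split=> //; split; rewrite ?mulmx0 ?mul0mx //.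
    by rewrite -{1}pgqu [u]flatmx0 mulmx0.
  by rewrite raddf0.
pose m j := projT1 (cid (H j)).
have mP j := projT2 (cid (H j)); rewrite -/(m _) in mP.
unshelve eexists (@Frame (fun j => (m j).1.1) g (fun j => (m j).1.2)
  (fun j => (m j).2) _ _ _ _ _ _ _) => // j;
  by have := mP j; rewrite -/(m j);
    case: (m j) => -[p u] q [[]] // ? ? ? ? ? H' // /H'[].
Qed.

Lemma finsupp_sub : {subset finsupp d' <= finsupp d}.
Proof. by move=> j; rewrite !mem_finsupp dE; case: (d' j). Qed.

Lemma mu_finsupp (x : rep K Q d') j :
  mu x j = \sum_(k <- finsupp d) \sum_(h : arr Q j k) sg h *: (x j k h *m x k j
    (bar h)).
Proof.
rewrite /mu (@big_fset_incl _ _ _ _ _ (finsupp d)) //.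
  by apply/fsubsetP; exact: finsupp_sub.
move=> k _ kd'; apply: big1 => h _; apply/matrixP => a b;
  rewrite !mxE big1 ?mulr0 //.
by move=> c _; case/negP: kd'; exact: dimv_gt0 c.
Qed.

(** [kap] is the quotient block and [nu] the off-diagonal block of the moment map of [form] at [i];
    see [mu_form]. *)
Definition kap (y : quotrep) : 'M[K]_l :=
  \sum_(h : arr Q i i) sg h *: (y i i h *m y i i (bar h)).

Definition nu (x : rep K Q d') (y : quotrep) (S : mixrep) : 'M[K]_(l, d' i) :=
  \sum_(k <- finsupp d) \sum_(h : arr Q i k) sg h *: (S i k h *m x k i (bar h))
    +
  \sum_(h : arr Q i i) sg h *: (y i i h *m S i i (bar h)).

(** Only [k = i] contributes; when [i] is outside the support, [fq fr i] has no rows. *)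
Lemma quot_sum (fr : frame) n (F : forall k, arr Q i k -> 'M[K]_(l, n)) :
  fq fr i *m (\sum_(k <- finsupp d) \sum_(h : arr Q i k) (k == i)%:R *: F k h) =
  fq fr i *m \sum_(h : arr Q i i) F i h.
Proof.
case: (boolP (i \in finsupp d)) => id; last first.
  by apply/matrixP => a; case/negP: id; exact: dimv_gt0 a.
rewrite (bigD1_seq i) ?fset_uniq //.
have -> : \sum_h (i == i)%:R *: F i h = \sum_h F i h.
  by apply: eq_bigr => h _; rewrite eqxx scale1r.
rewrite [X in _ *m (_ + X)]big1 ?addr0 // => k /negPf ki.
by apply: big1 => h _; rewrite ki scale0r.
Qed.

Lemma form_pair fr x y S j k (h : arr Q j k) :
  form fr x y S h *m form fr x y S (bar h) =
  fp fr j *m (x j k h *m x k j (bar h)) *m fg fr j +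
  fq fr j *m (S j k h *m x k j (bar h) *m fg fr j +
    (k == i)%:R *: (y j k h *m (S k j (bar h) *m fg fr j + y k j (bar h) *m fu
      fr j))).
Proof.
rewrite {1}/form mulmxDl -!mulmxA mulmxDl -!mulmxA g_form u_form.
by rewrite -scalemxAr.
Qed.

Lemma mu_form_neq fr x y S j : j != i ->
  mu (form fr x y S) j = fp fr j *m mu x j *m fg fr j.
Proof.
move=> ji; rewrite mu_finsupp mulmx_sumr mulmx_suml; apply: eq_bigr => k _.
rewrite mulmx_sumr mulmx_suml; apply: eq_bigr => h _.
by rewrite form_pair fq0 // mul0mx addr0 -scalemxAr -scalemxAl.
Qed.

Lemma mu_form fr x y S : mu (form fr x y S) i =
  fp fr i *m mu x i *m fg fr i +
  fq fr i *m (nu x y S *m fg fr i + kap y *m fu fr i).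
Proof.
have -> : fq fr i *m (nu x y S *m fg fr i + kap y *m fu fr i) =
    fq fr i *m \sum_(k <- finsupp d) \sum_(h : arr Q i k)
      sg h *: (S i k h *m x k i (bar h) *m fg fr i + (k == i)%:R *: (y i k h *m
        (S k i (bar h) *m fg fr i + y k i (bar h) *m fu fr i))).
  rewrite /nu mulmxDl -addrA mulmxDr !mulmx_suml -big_split /=.
  pose F k (h : arr Q i k) := sg h *: (y i k h *m (S k i (bar h) *m fg fr i +
    y k i (bar h) *m fu fr i)).
  have -> : \sum_(h : arr Q i i) (sg h *: (y i i h *m S i i (bar h)) *m fg fr i
    +
      sg h *: (y i i h *m y i i (bar h)) *m fu fr i) = \sum_(h : arr Q i i) F i
        h.
    by apply: eq_bigr => h _; rewrite /F mulmxDr !mulmxA scalerDr -!scalemxAl.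
  rewrite -(quot_sum fr F) -mulmxDr -big_split /=; congr (_ *m _).
  apply: eq_bigr => k _; rewrite mulmx_suml -big_split;
    apply: eq_bigr => h _ /=.
  by rewrite /F scalerDr -scalemxAl; congr (_ + _); rewrite !scalerA mulrC.
rewrite mu_finsupp /mu !mulmx_sumr mulmx_suml -big_split; apply: eq_bigr => k _.
rewrite !mulmx_sumr mulmx_suml -big_split; apply: eq_bigr => h _ /=.
by rewrite form_pair -/(sg h) scalerDr -!scalemxAr -!scalemxAl.
Qed.

Lemma g_mu fr x (B : rep K Q d) j :
  (forall j k (h : arr Q j k), fg fr j *m B j k h = x j k h *m fg fr k) ->
  mu x j *m fg fr j = fg fr j *m mu B j.
Proof.
move=> gB; rewrite mu_finsupp mulmx_suml mulmx_sumr; apply: eq_bigr => k _.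
rewrite mulmx_suml mulmx_sumr; apply: eq_bigr => h _.
by rewrite -scalemxAl -scalemxAr -mulmxA -gB !mulmxA gB.
Qed.

Lemma free_fg fr j : row_free (fg fr j).
Proof. by apply/row_freeP; exists (fp fr j); exact: fgp. Qed.

Lemma mu_form_eq0 fr x y S :
  (forall j, mu (form fr x y S) j = 0) <->
  [/\ forall j, mu x j = 0, nu x y S = 0 & kap y = 0].
Proof.
split=> [mu0|[mux nu0 kap0] j]; last first.
  have [->|ji] := eqVneq j i; last by rewrite mu_form_neq // mux mulmx0 mul0mx.
  by rewrite mu_form mux nu0 kap0 !(mulmx0, mul0mx, addr0).
have mux j : mu x j = 0.
  apply/eqP; rewrite -(mulmx_free_eq0 _ (free_fg fr j)).
  by rewrite (@g_mu fr x (form fr x y S)) ?mu0 ?mulmx0 // => *; exact: g_form.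
have := mu0 i; rewrite mu_form mux mulmx0 mul0mx add0r => E.
have {}E : nu x y S *m fg fr i + kap y *m fu fr i = 0.
  by rewrite -[LHS]mul1mx -(fuq1 fr) -mulmxA E mulmx0.
have nu0 := congr1 (mulmxr (fp fr i)) E.
have kap0 := congr1 (mulmxr (fq fr i)) E.
split=> //.
  by move: nu0; rewrite /= mulmxDl mul0mx -!mulmxA fgp fup mulmx0 addr0 mulmx1.
move: kap0; rewrite /= mulmxDl mul0mx -!mulmxA fgq fuq1 mulmx0 add0r.
by rewrite mulmx1.
Qed.

End Form.

(** * Flags of subrepresentations, quotients and extensions *)

Section Flags.
Variables (K : fieldType) (I : countType) (Q : quiver I).

Definition flag_rank (d : dimv I) (F : forall i, 'M[K]_(d i)) : nat :=
  (\sum_(i <- finsupp d) \rank (F i))%N.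

(* Unlike a complete flag, a weak flag may repeat a subspace, so that weak
   flags restrict to sub- and quotient representations. *)
Definition weak_flag (d : dimv I) (m : nat) (F : nat ->
  forall i, 'M[K]_(d i)) :=
  [/\ flag_rank (F 0%N) = 0%N, forall k i, (F k i <= F k.+1 i)%MS,
      forall k, (flag_rank (F k.+1) <= (flag_rank (F k)).+1)%N &
      (tdim d <= flag_rank (F m))%N].

Definition weak_compatible (d : dimv I) (B : rep K Q d) (m : nat)
    (F : nat -> forall i, 'M[K]_(d i)) :=
  (forall k i (h : arr Q i i), (k <= m)%N -> ~~ inOmega h ->
     (F k i *m B i i h <= F k i)%MS) /\
  (forall k i j (h : arr Q i j), (k < m)%N -> (i != j) || inOmega h ->
     (F k.+1 i *m B i j h <= F k j)%MS).

Section OneDimension.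
Variable d : dimv I.
Implicit Types F : nat -> forall i, 'M[K]_(d i).

Lemma flag_mono F k1 k2 i : (forall k i, (F k i <= F k.+1 i)%MS) ->
  (k1 <= k2)%N -> (F k1 i <= F k2 i)%MS.
Proof.
move=> Fmono /subnKC <-; elim: (k2 - k1)%N => [|j IH]; first by rewrite addn0.
by rewrite addnS (submx_trans IH).
Qed.

Lemma submx_dim0 i m (A : 'M[K]_(m, d i)) (B : 'M_(d i)) : i \notin finsupp d ->
  (A <= B)%MS.
Proof.
move=> id; apply/row_subP => a; rewrite (_ : row a A = 0) ?sub0mx //.
by apply/rowP => b; case/negP: id; exact: dimv_gt0 b.
Qed.

Lemma flag_rank_leq (F G : forall i, 'M[K]_(d i)) : (forall i,
  (F i <= G i)%MS) ->
  (flag_rank F <= flag_rank G)%N.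
Proof. by move=> FG; apply: leq_sum => i _; exact: mxrankS. Qed.

Lemma flag_rank_tdim (F : forall i, 'M[K]_(d i)) : (flag_rank F <= tdim d)%N.
Proof. by apply: leq_sum => i _; exact: rank_leq_col. Qed.

Lemma flag_rank_incr (F G : forall i, 'M[K]_(d i)) i r :
  (forall i, (F i <= G i)%MS) -> (flag_rank G <= flag_rank F + r)%N ->
  (\rank (G i) <= \rank (F i) + r)%N.
Proof.
move=> FG; case: (boolP (i \in finsupp d)) => id; last first.
  by move=> _; apply: leq_trans (leq_addr _ _); apply: mxrankS;
    exact: submx_dim0.
rewrite /flag_rank !(big_rem i id) /=.
have : (\sum_(j <- rem i (finsupp d)) \rank (F j) <=
        \sum_(j <- rem i (finsupp d)) \rank (G j))%N.
  by apply: leq_sum => j _; exact: mxrankS.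
move: (bigop _ _ _) (bigop _ _ _) => sF sG; lia.
Qed.

Lemma flag_rank_eq (F G : forall i, 'M[K]_(d i)) : (forall i,
  (F i <= G i)%MS) ->
  (flag_rank G <= flag_rank F)%N -> forall i, (G i <= F i)%MS.
Proof.
move=> FG GF i; rewrite -(mxrank_leqif_sup (FG i)) eqn_leq mxrankS //=.
by rewrite -[leqRHS]addn0; apply: flag_rank_incr; rewrite ?addn0.
Qed.

Lemma flag_rank_full (F : forall i, 'M[K]_(d i)) : (tdim d <= flag_rank F)%N ->
  forall i, row_full (F i).
Proof.
move=> fullF i; rewrite -sub1mx.
apply: (@flag_rank_eq F (fun i => 1%:M)) => [j|]; first exact: submx1.
exact: leq_trans (flag_rank_tdim _) fullF.
Qed.

Lemma complete_flag_weak F : complete_flag F -> weak_flag (tdim d) F.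
Proof.
move=> [Fmono Frank0].
have Frank k : (k <= tdim d)%N -> flag_rank (F k) = k by exact: Frank0.
split=> // [|k|]; try by rewrite Frank.
case: (ltnP k (tdim d)) => kd; first by rewrite !Frank // ltnW.
apply: leqW; apply: leq_trans (flag_rank_tdim _) _.
rewrite -{1}(Frank _ (leqnn _)); apply: flag_rank_leq => i.
exact: flag_mono.
Qed.

(** For each dimension, the first member of the weak flag that reaches it is kept. *)
Lemma weak_flag_complete (B : rep K Q d) m F :
  weak_flag m F -> weak_compatible B m F ->
  exists2 F', complete_flag F' & flag_compatible B F'.
Proof.
move=> [F0 Fmono Fstep Fm] [loopF arrF].
pose D k := flag_rank (F k).
have Dmono k1 k2 : (k1 <= k2)%N -> (D k1 <= D k2)%N.
  by move=> k12; apply: flag_rank_leq => i; exact: flag_mono.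
(* Capping at [tdim d] makes the first index exist for every [n], also beyond the length of the
   flag. *)
have exD n : exists k, (minn n (tdim d) <= D k)%N.
  by exists m; rewrite (leq_trans _ Fm) // geq_minr.
pose t n := ex_minn (exD n).
have tP n : (n <= tdim d)%N -> (n <= D (t n))%N.
  by rewrite /t => nd; case: ex_minnP => k; rewrite (minn_idPl nd).
have tmin n k : (n <= D k)%N -> (t n <= k)%N.
  rewrite /t => nk; case: ex_minnP => k' _; apply.
  by rewrite (leq_trans _ nk) // geq_minl.
have tm n : (t n <= m)%N.
  by rewrite /t; case: ex_minnP => k' _; apply;
    rewrite (leq_trans _ Fm) // geq_minr.
have DtE n : (n <= tdim d)%N -> D (t n) = n.
  move=> nd; apply/eqP; rewrite eqn_leq tP // andbT.
  case tE: (t n) => [|k]; first by rewrite /D F0.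
  have : (D k < n)%N by rewrite ltnNge; apply/negP => /tmin; rewrite tE ltnn.
  by apply: leq_trans; exact: Fstep.
exists (fun n => F (t n)); split.
- move=> n i; apply: flag_mono => //; rewrite /t.
  case: ex_minnP => k _; apply; case: ex_minnP => k' k'P _.
  by apply: leq_trans k'P; rewrite leq_min !(geq_minr,
    leq_trans (geq_minl _ _)).
- by move=> n /DtE.
- by move=> n i h nd hO; apply: loopF.
move=> n i j h nd hO; case tE: (t n.+1) => [|k].
  by have := DtE _ nd; rewrite tE /D F0.
(* The predecessor [F k] of the first member of dimension [n.+1] has dimension exactly [n], so it
   equals the chosen [F (t n)] and the drop by one step survives. *)
have kn : (D k <= n)%N by rewrite leqNgt; apply/negP => /tmin; rewrite tE ltnn.
have ntk : (t n <= k)%N.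
  by apply: tmin; have := DtE _ nd; rewrite tE -ltnS => <-; exact: Fstep.
apply: submx_trans (arrF k i j h _ hO) _; first by rewrite -tE tm.
apply: flag_rank_eq => [i'|]; first exact: flag_mono.
by rewrite -/(D k) -/(D (t n)) DtE // ltnW.
Qed.

End OneDimension.

Variables (d d' : dimv I) (i : I) (l : nat).
Hypothesis dE : forall j, d j = (d' j + (if j == i then l else 0))%N.

Lemma flag_rank_finsupp (F : forall j, 'M[K]_(d' j)) :
  flag_rank F = (\sum_(j <- finsupp d) \rank (F j))%N.
Proof.
rewrite /flag_rank (@big_fset_incl _ _ _ _ _ (finsupp d)) //.
  by apply/fsubsetP; exact: finsupp_sub dE.
move=> j _ jd'; apply/eqP; rewrite -leqn0 (leq_trans (rank_leq_col _)) //.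
by rewrite leqn0; move: jd'; rewrite mem_finsupp negbK.
Qed.

Section SubQuotient.
Variables (fr : @frame K I d d' i l) (x : rep K Q d') (B : rep K Q d).
Hypothesis gB : forall j k (h : arr Q j k),
  fg fr j *m @B _ _ h = @x _ _ h *m fg fr k.

(** Intersecting with the subspace lets some steps of the flag stall, hence the detour through weak
    flags. *)
Lemma sub_flag F : complete_flag F -> flag_compatible B F ->
  exists2 F', complete_flag F' & flag_compatible x F'.
Proof.
move=> cF [loopF arrF]; have [F0 Fmono Fstep Fm] := complete_flag_weak cF.
pose G k j := <<(F k j :&: fg fr j)%MS *m fp fr j>>%MS.
have Gg k j : (G k j *m fg fr j :=: F k j :&: fg fr j)%MS.
  have /submxP[c cE] : (F k j :&: fg fr j <= fg fr j)%MS by exact: capmxSr.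
  apply: eqmx_trans (eqmxMr _ (genmxE _)) _.
  by rewrite cE -!mulmxA (mulmxA (fg _ _)) fgp mul1mx.
have Grank k j : \rank (G k j) = \rank (F k j :&: fg fr j)%MS.
  by rewrite -Gg mxrankMfree // free_fg.
have Bcap k k' j j' (h : arr Q j j') : (F k j *m @B _ _ h <= F k' j')%MS ->
    (G k j *m @x _ _ h <= G k' j')%MS.
  move=> FB; rewrite -(submxMfree _ _ (free_fg fr j')) -mulmxA -gB mulmxA.
  rewrite !Gg sub_capmx; apply/andP; split.
    by apply: submx_trans FB; rewrite submxMr // Gg capmxSl.
  by rewrite -mulmxA gB mulmxA submxMl.
apply: (@weak_flag_complete _ _ (tdim d) G); split.
- rewrite flag_rank_finsupp; apply/eqP; rewrite -leqn0 -[leqRHS]F0;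
    apply: leq_sum => j _.
  by rewrite Grank mxrankS // capmxSl.
- move=> k j; rewrite -(submxMfree _ _ (free_fg fr j)) !Gg.
  by rewrite capmxS // Fmono.
- move=> k; rewrite !flag_rank_finsupp.
  have : (\sum_(j <- finsupp d) (\rank (G k.+1 j) + \rank (F k j)) <=
          \sum_(j <- finsupp d) (\rank (F k.+1 j) + \rank (G k j)))%N.
    by apply: leq_sum => j _; rewrite !Grank; exact: rank_incr_cap.
  rewrite !big_split /=; have := Fstep k; rewrite /flag_rank.
  move: (bigop _ _ _) (bigop _ _ _) (bigop _ _ _) (bigop _ _ _); lia.
- rewrite flag_rank_finsupp.
  have -> : tdim d' = (\sum_(j <- finsupp d) d' j)%N.
    rewrite /tdim (@big_fset_incl _ _ _ _ _ (finsupp d)) //.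
      by apply/fsubsetP; exact: finsupp_sub dE.
    by move=> j _; rewrite mem_finsupp negbK => /eqP.
  apply: leq_sum => j _; rewrite Grank.
  rewrite (capmx_idPr (submx_full _ (flag_rank_full Fm j))).
  by rewrite (eqP (free_fg fr j)).
- by move=> k j h km hO; apply: Bcap; exact: loopF.
- by move=> k j j' h km hO; apply: Bcap; exact: arrF.
Qed.

(** The flag projects to a weak flag of the quotient at [i]. In a basis adapted to it, stability
    reads as triangularity and the drop by one step as strict triangularity. *)
Lemma quot_flag F : complete_flag F -> flag_compatible B F ->
  exists2 P : 'M_l, P \in unitmx & forall h : arr Q i i,
    let y := P *m (fu fr i *m @B _ _ h *m fq fr i) *m invmx P in
    if inOmega h then strict_trig y else is_trig_mx y.
Proof.
move=> cF [loopF arrF]; have [F0 Fmono Fstep Fm] := complete_flag_weak cF.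
pose G k := <<F k i *m fq fr i>>%MS; pose m := tdim d.
have Fstep1 k : (\rank (F k.+1 i) <= (\rank (F k i)).+1)%N.
  have := @flag_rank_incr d (F k) (F k.+1) i 1 (Fmono k).
  by rewrite !addn1; apply; exact: Fstep.
have Gmono k : (G k <= G k.+1)%MS by rewrite !genmxE submxMr // Fmono.
have Gstep k : (\rank (G k.+1) <= (\rank (G k)).+1)%N.
  rewrite !genmxE; have := rank_incr_mul (fq fr i) (Fmono k i).
  have := Fstep1 k; lia.
have Gm : row_full (G m).
  rewrite -sub1mx genmxE -(fuq1 fr) submxMr //.
  exact: submx_full (flag_rank_full Fm i).
have F0i : F 0%N i = 0.
  apply/eqP; rewrite -submx0.
  apply: (@flag_rank_eq _ (fun j => 0) (F 0%N)) => [j|]; first exact: sub0mx.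
  by rewrite F0.
have G0 : G 0%N = 0 by rewrite /G F0i mul0mx genmx0.
have [P uP PE] := flag_basis G0 Gmono Gstep Gm; exists P => //.
have rmono k1 k2 : (k1 <= k2)%N -> (\rank (G k1) <= \rank (G k2))%N.
  move=> /subnKC <-; elim: (k2 - k1)%N => [|j IH]; first by rewrite addn0.
  by rewrite addnS (leq_trans IH) // mxrankS // Gmono.
(* [k.+1] is the step at which the projected flag acquires the basis vector with index [a]. *)
have jump (a : 'I_l) : exists k, [/\ (k < m)%N,
  \rank (G k) = a & \rank (G k.+1) = a.+1].
  have ex : exists k, (a < \rank (G k))%N by exists m; rewrite (eqP Gm).
  case: (ex_minnP ex) => -[|k] ak mink; first by rewrite G0 mxrank0 in ak.
  have ka : (\rank (G k) <= a)%N by rewrite leqNgt; apply/negP => /mink;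
    rewrite ltnn.
  exists k; split.
  - by rewrite ltnNge; apply/negP => /rmono; rewrite (eqP Gm);
      have := ltn_ord a; lia.
  - by have := Gstep k; lia.
  - by have := Gstep k; lia.
pose y0 h := fu fr i *m @B _ _ h *m fq fr i.
have By h : @B i i h *m fq fr i = fq fr i *m y0 h.
  rewrite /y0 !mulmxA -(addrK (fp fr i *m fg fr i) (fq fr i *m fu fr i)).
  rewrite [fq fr i *m fu fr i + _]addrC fpgqu mulmxBl mul1mx mulmxBl.
  by rewrite -(mulmxA (fp _ _)) gB -!mulmxA fgq !mulmx0 subr0.
have Gy k k' h : (F k i *m @B i i h <= F k' i)%MS -> (G k *m y0 h <= G k')%MS.
  move=> FB; rewrite (eqmxMr _ (genmxE _)) genmxE -mulmxA -By mulmxA.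
  by rewrite submxMr.
have entry0 (a b : 'I_l) k k' h : (k <= m)%N -> (k' <= m)%N ->
  (a < \rank (G k))%N ->
    (\rank (G k') <= b)%N -> (F k i *m @B i i h <= F k' i)%MS ->
    (P *m y0 h *m invmx P) a b = 0.
  move=> km k'm ak kb /Gy yG.
  have : (row a (P *m y0 h *m invmx P) <= (pid_mx (\rank (G k')) : 'M_l))%MS.
    have -> : row a (P *m y0 h *m invmx P) =
        row a ((pid_mx (\rank (G k)) : 'M_l) *m P) *m y0 h *m invmx P.
      by rewrite !row_mul row_pid_mx ak scale1r -rowE.
    rewrite -[X in (_ <= X)%MS](mulmxK uP) submxMr // -(PE k') //.
    apply: submx_trans yG; rewrite submxMr // (PE k) //.
    exact: row_sub.
  move=> /submxP[c /rowP/(_ b)]; rewrite [in LHS]mxE => ->.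
  rewrite mxE big1 // => e _; rewrite mxE; case: eqP => [eb|];
    rewrite ?mulr0 //.
  by rewrite eb ltnNge kb mulr0.
move=> h /=; rewrite -/(y0 h); case: ifPn => hO.
  move=> a b ab; have [k [km ra ra1]] := jump a.
  apply: (entry0 a b k.+1 k) => //; rewrite ?ra ?ra1 ?(ltnW km) //.
  by apply: arrF; rewrite ?hO ?orbT.
apply/is_trig_mxP => a b ab; have [k [km ra ra1]] := jump a.
apply: (entry0 a b k.+1 k.+1) => //; rewrite ?ra1 //.
exact: loopF.
Qed.

End SubQuotient.

(** The flag of [x] is followed by the coordinate flag of the quotient, [pm k] being the projection
    to its first [k] coordinates. *)
Lemma form_flag (fr : @frame K I d d' i l) x y S F :
    complete_flag F -> flag_compatible x F ->
    (forall h : arr Q i i, if inOmega h then strict_trig (y i i h)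
                           else is_trig_mx (y i i h)) ->
  exists2 F', complete_flag F' & flag_compatible (form fr x y S : rep K Q d) F'.
Proof.
move=> cF [loopF arrF] ytrig; have [F0 Fmono Fstep Fm] := complete_flag_weak cF.
pose m := tdim d'; pose pm k : 'M[K]_l := pid_mx k.
pose G k j := (F k j *m fg fr j + pm (k - m)%N *m fu fr j)%MS.
have pmE k n (X : 'M[K]_(n, l)) a b : (X *m pm k) a b = X a b *+ (b < k)%N.
  rewrite mxE (bigD1 b) //= big1 => [|c cb]; last first.
    by rewrite mxE val_eqE (negPf cb) mulr0.
  by rewrite mxE eqxx addr0 mulr_natr.
have pmE' k (z : 'M[K]_l) a b : (pm k *m z) a b = z a b *+ (a < k)%N.
  have := congr1 (fun A : 'M[K]_(1, l) => A 0 b) (row_mul a (pm k) z).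
  rewrite row_pid_mx -scalemxAl -rowE [row a _ 0 b]mxE => ->.
  by rewrite !mxE mulrC mulr_natr.
have pm_trig k (z : 'M[K]_l) : is_trig_mx z -> (pm k *m z <= pm k)%MS.
  move=> /is_trig_mxP tz; suff -> : pm k *m z = pm k *m z *m pm k by exact:
    submxMl.
  apply/matrixP => a b; rewrite pmE !pmE'; case: (ltnP b k) => // kb.
  by case: (ltnP a k) => // ak; rewrite tz // (leq_trans ak).
have pm_strict k (z : 'M[K]_l) : strict_trig z -> (pm k.+1 *m z <= pm k)%MS.
  move=> tz; suff -> : pm k.+1 *m z = pm k.+1 *m z *m pm k by exact: submxMl.
  apply/matrixP => a b; rewrite pmE !pmE'; case: (ltnP b k) => // kb.
  by case: (ltnP a k.+1) => // ak; rewrite tz // (leq_trans _ kb).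
have Ffull k j : (m <= k)%N -> row_full (F k j).
  move=> mk; rewrite -sub1mx; apply: submx_trans (flag_mono j Fmono mk).
  by rewrite sub1mx; exact: flag_rank_full.
have pm0 k : (k <= m)%N -> pm (k - m)%N = 0.
  by move=> /eqP ->; apply/matrixP => a b; rewrite !mxE andbF.
have Flast k j n (X : 'M[K]_(n, d' j)) : (m <= k)%N ->
  (X *m fg fr j <= G k j)%MS.
  move=> mk; apply: submx_trans (addsmxSl _ _).
  by rewrite submxMr // submx_full // Ffull.
have Gmono k j : (G k j <= G k.+1 j)%MS.
  apply: addsmxS; first by rewrite submxMr // Fmono.
  rewrite submxMr //.
  suff -> : pm (k - m)%N = pm (k - m)%N *m pm (k.+1 - m)%N by exact: submxMl.
  apply/matrixP => a b; rewrite pmE !mxE; case: (ltnP b (k.+1 - m)) => // kb.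
  by case: eqP => //= ab; have -> : (a < k - m)%N = false by lia.
(* If [k > m], the bound gives [m <= n], so [G n] contains the whole subrepresentation and [S]
   imposes no condition; if [k <= m], the quotient part of [G k] is zero. *)
have arrG k n j j' (h : arr Q j j') : (k <= n.+1)%N ->
    (F k j *m x _ _ h <= F n j')%MS ->
    (j = i -> j' = i -> (pm (k - m)%N *m y _ _ h <= pm (n - m)%N)%MS) ->
    (G k j *m form fr x y S h <= G n j')%MS.
  move=> kn Fx py; rewrite addsmxMr addsmx_sub; apply/andP; split.
    rewrite -mulmxA g_form mulmxA.
    by apply: submx_trans (addsmxSl _ _); rewrite submxMr.
  rewrite -mulmxA u_form; case: eqP => ji;
    last by rewrite scale0r mulmx0 sub0mx.
  case: (leqP k m) => [/pm0 ->|mk]; first by rewrite mul0mx sub0mx.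
  rewrite scale1r mulmxDr addmx_sub // mulmxA; first by apply: Flast; lia.
  have [j'i|j'i] := eqVneq j' i; last by rewrite fu0 // mulmx0 sub0mx.
  by apply: submx_trans (addsmxSr _ _); rewrite submxMr // py.
apply: (@weak_flag_complete _ _ (m + l) G); split.
- rewrite /flag_rank big1 // => j _; apply/eqP; rewrite mxrank_eq0.
  rewrite -submx0 /G pm0 // mul0mx addsmx_sub sub0mx andbT.
  suff /eqP -> : F 0%N j == 0 by rewrite mul0mx sub0mx.
  rewrite -submx0; apply: (@flag_rank_eq _ (fun j => 0) (F 0%N)) => [j'|].
    exact: sub0mx.
  by rewrite F0.
- by move=> k j; exact: Gmono.
- move=> k; case: (ltnP k m) => km.
    have Gk n : (n <= m)%N -> flag_rank (G n) = flag_rank (F n).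
      move=> nm; rewrite flag_rank_finsupp; apply: eq_bigr => j _.
      by rewrite /G pm0 // mul0mx addsmx0 mxrankMfree // free_fg.
    by rewrite !Gk ?(ltnW km) //; exact: Fstep.
  (* The increment of [pm] from one step to the next: a diagonal matrix unit, or zero once [k - m]
     has passed [l]. *)
  pose E : 'M[K]_l := \matrix_(a, b) ((a == b) && (a == k - m :> nat)%N)%:R.
  have rE : (\rank E <= 1)%N.
    case: (ltnP (k - m) l) => kl; last first.
      rewrite (_ : E = 0) ?mxrank0 //; apply/matrixP => a b; rewrite !mxE.
      by rewrite (ltn_eqF (leq_trans (ltn_ord a) kl)) andbF.
    rewrite (_ : E = delta_mx (Ordinal kl) (Ordinal kl)) ?mxrank_delta //.
    apply/matrixP => a b; rewrite !mxE -!val_eqE /=; congr (nat_of_bool _)%:R.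
    by apply/andP/andP => -[/eqP -> /eqP ->]; rewrite !eqxx.
  have pmS : pm (k.+1 - m)%N = pm (k - m)%N + E.
    apply/matrixP => a b; rewrite !mxE -val_eqE /= -natrD; congr (_%:R).
    by case: eqP => //= ab; rewrite subSn // ltnS leq_eqVlt; case: ltngtP.
  have GE j : (\rank (G k.+1 j) <= \rank (G k j) + (j == i))%N.
    have sG : (G k.+1 j <= G k j + (E *m fu fr j))%MS.
      rewrite {1}/G addsmx_sub; apply/andP; split.
        by apply: submx_trans (addsmxSl _ _); rewrite Flast.
      rewrite pmS mulmxDl addmx_sub ?addsmxSr //.
      by apply: submx_trans (addsmxSl _ _); exact: addsmxSr.
    apply: leq_trans (mxrankS sG) _; apply: leq_trans (mxrank_adds_leqif _ _) _.
    rewrite leq_add2l; have [_|ji] := eqVneq j i;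
      last by rewrite fu0 // mulmx0 mxrank0.
    exact: leq_trans (mxrankM_maxl _ _) rE.
  apply: leq_trans (leq_sum _ (fun j _ => GE j)) _.
  rewrite big_split /= -addn1 leq_add2l.
  rewrite -big_mkcond /= sum1_count.
  by rewrite count_uniq_mem ?fset_uniq // leq_b1.
- rewrite /tdim; apply: leq_sum => j _.
  suff /eqP -> : row_full (G (m + l)%N j) by [].
  rewrite -sub1mx -(fpgqu fr j) addmx_sub //; first by rewrite Flast ?leq_addr.
  apply: submx_trans (addsmxSr _ _); rewrite addKn.
  by rewrite (_ : pm l = 1%:M) ?mul1mx ?submxMl // /pm pid_mx_1.
- move=> k j h kml hO; apply: arrG; first exact: leqnSn.
    case: (leqP k m) => km; first exact: loopF.
    by apply: submx_full; apply: Ffull; exact: ltnW.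
  move=> ji _; subst j; apply: pm_trig; move: (ytrig h).
  by rewrite (negPf hO).
- move=> k j j' h kml hO; apply: arrG => //.
    case: (ltnP k m) => km; first exact: arrF.
    by apply: submx_full; apply: Ffull.
  move=> ji j'i; subst j j'; move: hO (ytrig h); rewrite eqxx /= => -> st.
  case: (ltnP k m) => km; first by rewrite pm0 // mul0mx sub0mx.
  by rewrite subSn // pm_strict.
Qed.

End Flags.

(** * Restriction to W and its converse *)

Lemma row_free_basis (K : fieldType) m n p (M : 'M[K]_(p, n)) : \rank M = m ->
  exists2 g : 'M_(m, n), row_free g & (g :=: M)%MS.
Proof. by move=> <-; exists (row_base M);
  [exact: row_base_free|exact: eq_row_base]. Qed.

Section Restrictions.
Variables (K : numClosedFieldType) (I : countType) (Q : quiver I).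
Variables (d d' : dimv I) (i : I) (l : nat).
Hypothesis dE : forall j, d j = (d' j + (if j == i then l else 0))%N.

Local Notation frame := (@frame K I d d' i l).
Local Notation quotrep := (@quotrep K I Q l).
Local Notation mixrep := (@mixrep K I Q d' l).

Implicit Types (x : rep K Q d') (B : rep K Q d).

Definition W_family (B : rep K Q d) j : 'M[K]_(d j) :=
  if j == i then W_ B j else 1%:M.

Lemma W_family_stable B j k (h : arr Q j k) :
  (W_family B j *m B j k h <= W_family B k)%MS.
Proof.
rewrite /W_family; have [ki|_] := eqVneq k i; last exact: submx1.
subst k; have [ji|ji] := eqVneq j i; first by subst j; exact: W_loop.
by rewrite mul1mx (submx_trans (sub_in_image _ h ji)) // in_image_W.
Qed.

Lemma restriction_exists B : eps_rep B i = l -> exists x : rep K Q d',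
  iso_restriction B (W_family B) x.
Proof.
move=> epsB; have rW j : \rank (W_family B j) = d' j.
  rewrite /W_family; have := dE j; case: (eqVneq j i) => [ji|_] dj; last first.
    by rewrite mxrank1 dj addn0.
  subst j; have := rank_leq_col (W_ B i).
  by move: epsB dj; rewrite /eps_rep; move: (\rank _) => r; lia.
pose g j := projT1 (cid2 (row_free_basis (rW j))).
have gP j : row_free (g j) /\ (g j :=: W_family B j)%MS.
  by rewrite /g; case: cid2.
have [fr frg] := frame_exists dE (fun j => (gP j).1).
exists (fun j k h => fg fr j *m B j k h *m fp fr k).
exists (fg fr); split=> [j|j|j k h]; rewrite ?frg;
  [exact: (gP j).1|exact: (gP j).2|].
have /submxP[c cE] : (g j *m B j k h <= g k)%MS.
  by rewrite (gP k).2 (submx_trans _ (W_family_stable B h)) // submxMr // (gP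
    j).2.
by rewrite cE -{1}frg -(mulmxA c) fgp mulmx1.
Qed.

Lemma restriction_frame B x : iso_restriction B (W_family B) x ->
  exists2 fr : frame, (fg fr i :=: W_ B i)%MS &
    forall j k (h : arr Q j k), fg fr j *m B j k h = x j k h *m fg fr k.
Proof.
move=> [g [freeg gW gB]]; have [fr frg] := frame_exists dE freeg.
exists fr => [|j k h]; rewrite frg ?gB //.
by move: (gW i); rewrite /W_family eqxx.
Qed.

Lemma fg_neq_full (fr : frame) j : j != i -> row_full (fg fr j).
Proof.
by move=> ji; rewrite -sub1mx -(fpgqu fr j) fq0 // mul0mx addr0 submxMl.
Qed.

Lemma frame_restriction (fr : frame) B x : (fg fr i :=: W_ B i)%MS ->
    (forall j k (h : arr Q j k), fg fr j *m B j k h = x j k h *m fg fr k) ->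
  iso_restriction B (W_family B) x /\ eps_rep B i = l.
Proof.
move=> gW gB; split.
  exists (fg fr); split=> // j; first exact: free_fg.
  rewrite /W_family; have [->//|ji] := eqVneq j i.
  by apply/eqmxP; rewrite submx1 submx_full // fg_neq_full.
by rewrite /eps_rep -gW (eqP (free_fg fr i)) dE eqxx addKn.
Qed.

(** The image of [W_ x i] contains the images of the arrows of [B] into [i] and is stable under its
    loops, so it is all of [W_ B i]. *)
Lemma restriction_eps (fr : frame) B x : (fg fr i :=: W_ B i)%MS ->
    (forall j k (h : arr Q j k), fg fr j *m B j k h = x j k h *m fg fr k) ->
  eps_rep x i = 0%N.
Proof.
move=> gW gB; suff WB : (W_ B i <= W_ x i *m fg fr i)%MS.
  apply/eqP; rewrite subn_eq0 -{1}(eqP (free_fg fr i)) gW.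
  exact: leq_trans (mxrankS WB) (mxrankM_maxl _ _).
apply: W_min => [|h]; last first.
  by rewrite -mulmxA gB mulmxA submxMr // W_loop.
apply: in_image_min => j h ji.
rewrite -[B j i h]mul1mx -(fpgqu fr j) fq0 // mul0mx addr0 -mulmxA gB mulmxA.
rewrite submxMr // (submx_trans (submxMl _ _)) //.
by rewrite (submx_trans (sub_in_image x h ji)) // in_image_W.
Qed.

Lemma restriction_N (fr : frame) B x : N_ d B ->
    (forall j k (h : arr Q j k), fg fr j *m B j k h = x j k h *m fg fr k) ->
  N_ d' x.
Proof.
move=> [[F cF flagF] muB rsB] gB; split.
- exact: (sub_flag dE gB cF flagF).
- move=> j; apply/eqP; rewrite -(mulmx_free_eq0 _ (free_fg fr j)).
  by rewrite (g_mu dE j gB) muB mulmx0.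
- move=> j h hO; apply: regular_semisimple_sub (free_fg fr j) _ (rsB j h hO).
  exact: gB.
Qed.

Definition triangular (y : quotrep) := forall h : arr Q i i,
  if inOmega h then strict_trig (y i i h) else is_trig_mx (y i i h).

(* Nonvanishing of [disc] says that the eigenvalues of each [y h] are distinct
   and are not eigenvalues of [x h]. *)
Definition disc (x : rep K Q d') (y : quotrep) : K :=
  \prod_(h : arr Q i i | ~~ inOmega h)
    ((\prod_(ab : 'I_l * 'I_l | ab.1 != ab.2) (y i i h ab.1 ab.1 - y i i h ab.2
      ab.2)) *
     \prod_(a < l) \det (x i i h - (y i i h a a)%:M)).

Lemma disc_neq0 x y : disc x y != 0 <->
  forall h : arr Q i i, ~~ inOmega h -> injective (fun a => y i i h a a) /\
    forall a, \det (x i i h - (y i i h a a)%:M) != 0.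
Proof.
split=> [|H].
  move=> /prodf_neq0 H h hO; have := H h hO; rewrite mulf_eq0 negb_or.
  case/andP=> /prodf_neq0 Hy /prodf_neq0 Hx; split=> [a b|a]; last exact: Hx.
  move=> yab; apply/eqP; apply: contraT => ab.
  by have := Hy (a, b) ab; rewrite /= yab subrr eqxx.
apply/prodf_neq0 => h hO; have [inj_y detx] := H h hO.
apply: mulf_neq0; apply/prodf_neq0; last by move=> a _; exact: detx.
move=> [a b] /= ab.
by rewrite subr_eq0; apply: contra_neq ab; exact: inj_y.
Qed.

Definition quot_point x y := [/\ triangular y, kap i y = 0 & disc x y != 0].

Lemma frame_quot_conj (fr : frame) P : P \in unitmx -> exists fr' : frame,
  [/\ fp fr' = fp fr, fg fr' = fg fr, fu fr' = (fun j => P *m fu fr j) &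
      fq fr' = (fun j => fq fr j *m invmx P)].
Proof.
move=> uP; unshelve eexists (@Frame K I d d' i l (fp fr) (fg fr)
  (fun j => P *m fu fr j) (fun j => fq fr j *m invmx P) (fgp fr) _ _ _ _ _ _).
- by move=> j /=; rewrite mulmxA mulmxKV // fpgqu.
- by move=> j /=; rewrite mulmxA fgq mul0mx.
- by move=> j /=; rewrite -mulmxA fup mulmx0.
- move=> j /=; rewrite -mulmxA (mulmxA (fu _ _)) fuq mulmxA scalar_mxC -mulmxA.
  by rewrite mulmxV // mulmx1.
- by move=> j ji /=; rewrite fq0 // mul0mx.
- by move=> j ji /=; rewrite fu0 // mulmx0.
- by [].
Qed.

Lemma decomposition B x : N_ d B -> iso_restriction B (W_family B) x ->
  exists (fr : frame) (y : quotrep) (S : mixrep),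
    [/\ B = form fr x y S, quot_point x y & nu d i x y S = 0].
Proof.
move=> [[F cF flagF] muB rsB] /restriction_frame[fr0 gW gB].
have [P uP PT] := quot_flag gB cF flagF.
(* The flag of [B] dictates the basis of the quotient in which [y] is triangular. *)
have [fr [frp frg fru frq]] := frame_quot_conj fr0 uP.
rewrite -frg in gB.
pose y : quotrep := fun j k h => fu fr j *m B j k h *m fq fr k.
pose S : mixrep := fun j k h => fu fr j *m B j k h *m fp fr k.
have BE : B = form fr x y S by apply: form_unique.
have [|_ nu0 kap0] := (mu_form_eq0 dE fr x y S).1; first by rewrite -BE.
have yT : triangular y.
  by move=> h; move: (PT h); rewrite /y /= fru frq !mulmxA.
exists fr, y, S; split=> //; split=> //; apply/disc_neq0 => h hO.
have ty : is_trig_mx (y i i h) by move: (yT h); rewrite (negPf hO).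
have [|_ inj_y detx] := (regular_semisimple_frame (fgp fr i) (fpgqu fr i)
  (fgq fr i) (fup fr i) (fuq1 fr) (gB i i h) ty).1; first exact: rsB.
by split.
Qed.

(** The converse of [decomposition]. Its point is that [W_ B i] is no smaller than the embedded
    space, and this comes from [eps_rep x i = 0]. *)
Lemma construction (fr : frame) x y (S : mixrep) (B :=
  form fr x y S : rep K Q d) :
    N_ d' x -> eps_rep x i = 0%N -> quot_point x y -> nu d i x y S = 0 ->
  [/\ N_ d B, iso_restriction B (W_family B) x & eps_rep B i = l].
Proof.
move=> [[F cF flagF] mux rsx] epsx [yT kap0 /disc_neq0 rsy] nu0.
have gB j k (h : arr Q j k) : fg fr j *m B j k h = x j k h *m fg fr k.
  exact: g_form.
have NB : N_ d B.
  split.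
  - exact: (form_flag dE fr S cF flagF yT).
  - exact: (mu_form_eq0 dE fr x y S).2.
  move=> j h hO; have [ji|ji] := eqVneq j i; last first.
    apply: (@regular_semisimple_sub _ _ _ (fp fr j) (x j j h)) (rsx j h hO).
      by apply/row_freeP; exists (fg fr j);
        rewrite -(fpgqu fr j) fq0 // mul0mx addr0.
    by rewrite form_p fq0 // mul0mx addr0.
  subst j; have yE : fu fr i *m B i i h *m fq fr i = y i i h.
    by rewrite u_form eqxx scale1r mulmxDl -!mulmxA fgq fuq1 mulmx0 add0r
      mulmx1.
  apply: (regular_semisimple_frame (fgp fr i) (fpgqu fr i) (fgq fr i) (fup fr i)
    (fuq1 fr) (gB i i h) _).2; rewrite yE.
    by move: (yT h); rewrite (negPf hO).
  by have [] := rsy h hO; split=> //; exact: rsx.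
suff gW : (fg fr i :=: W_ B i)%MS.
  by have [] := frame_restriction gW gB.
have Wfull : row_full (W_ x i).
  by rewrite /row_full eqn_leq rank_leq_col -subn_eq0 -/(eps_rep x i) epsx.
apply/eqmxP/andP; split; last first.
  apply: W_min => [|h]; last by rewrite gB submxMl.
  apply: in_image_min => j h ji.
  by rewrite /B /form fq0 // mul0mx addr0 submxMl.
(* [M] consists of the vectors whose image lies in [W_ B i]. It has the two closure properties that
   define [W_ x i], which is the full space. *)
pose M := kermx (fg fr i *m cokermx (W_ B i)).
have ME n (v : 'M[K]_(n, d' i)) : (v <= M)%MS = (v *m fg fr i <= W_ B i)%MS.
  by rewrite sub_kermx submxE mulmxA.
rewrite -[fg fr i]mul1mx -ME; apply: submx_trans (_ : W_ x i <= M)%MS.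
  by rewrite sub1mx.
apply: W_min => [|h].
  apply: in_image_min => j h ji; rewrite ME -gB (submx_trans (submxMl _ _)) //.
  by rewrite (submx_trans (sub_in_image B h ji)) // in_image_W.
rewrite ME -mulmxA -gB mulmxA; apply: submx_trans (W_loop B h).
by rewrite submxMr // -ME.
Qed.

End Restrictions.

(** * Irreducibility of the strata *)

Section GeneratedAlgebras.
Variable K : fieldType.

Inductive genfun (T : Type) (G : set (T -> K)) : (T -> K) -> Prop :=
| genfun_cst c : genfun G (fun=> c)
| genfun_gen f : G f -> genfun G f
| genfun_add f g : genfun G f -> genfun G g -> genfun G (fun t => f t + g t)
| genfun_mul f g : genfun G f -> genfun G g -> genfun G (fun t => f t * g t).

Lemma funalg_genfun T (G : set (T -> K)) : funalg (genfun G).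
Proof. by split; [exact: genfun_cst|exact: genfun_add|exact: genfun_mul]. Qed.

Lemma genfun_ratmap T T' (A : set (T -> K)) D (G : set (T' -> K)) (m : T ->
  T') :
    funalg A -> A D ->
    (forall f, G f -> exists2 c, A c & forall t, D t != 0 ->
      D t * f (m t) = c t) ->
  ratmap A D (genfun G) m.
Proof.
move=> algA AD Gm f; elim=> [c|{}f /Gm[c Ac cE]|{}f g _ [n [c Ac cE]] _ [n' [c'
  Ac' cE']]|
  {}f g _ [n [c Ac cE]] _ [n' [c' Ac' cE']]].
- exists 0%N, (fun=> c); first exact: fa_cst.
  by move=> t _; rewrite expr0 mul1r.
- by exists 1%N, c => // t Dt; rewrite expr1 cE.
- exists (n + n')%N, (fun t => D t ^+ n' * c t + D t ^+ n * c' t).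
    by apply: fa_add => //; apply: fa_mul => //; exact: fa_exp.
  by move=> t Dt; rewrite -cE // -cE' // exprD; ring.
- exists (n + n')%N, (fun t => c t * c' t); first exact: fa_mul.
  by move=> t Dt; rewrite -cE // -cE' // exprD; ring.
Qed.

Lemma genfun_polymap T T' (A : set (T -> K)) (G : set (T' -> K)) (m : T -> T') :
    funalg A -> (forall f, G f -> A (fun t => f (m t))) ->
  ratmap A (fun=> 1) (genfun G) m.
Proof.
move=> algA Gm; apply: genfun_ratmap => //; first exact: fa_cst.
by move=> f /Gm Af; exists (fun t => f (m t)) => // t _; rewrite mul1r.
Qed.

Variables (I : countType) (Q : quiver I).

Definition coords (m n : I -> I -> nat) :
    set ((forall i j, arr Q i j -> 'M[K]_(m i j, n i j)) -> K) :=
  [set f | exists i j (h : arr Q i j) a b,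
    f = fun B : forall i j, arr Q i j -> 'M[K]_(m i j, n i j) => B i j h a b].

Lemma polyfun_genfun d (f : rep K Q d -> K) : polyfun f ->
  genfun (@coords (fun i _ => d i) (fun _ j => d j)) f.
Proof.
elim=> [c|i j h a b|p q _ Hp _ Hq|p q _ Hp _ Hq].
- exact: genfun_cst.
- by apply: genfun_gen; exists i, j, h, a, b.
- exact: genfun_add.
- exact: genfun_mul.
Qed.

Lemma polyfun_ratmap T (A : set (T -> K)) D d (m : T -> rep K Q d) :
    funalg A -> A D ->
    (forall i j (h : arr Q i j), exists2 N, mxin A N &
       forall t, D t != 0 -> D t *: m t i j h = N t) ->
  ratmap A D (@polyfun K I Q d) m.
Proof.
move=> algA AD mP f /polyfun_genfun.
apply: (@genfun_ratmap _ (forall i j, arr Q i j -> 'M[K]_(d i, d j))) => //.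
move=> _ [i [j [h [a [b ->]]]]]; have [N AN NE] := mP i j h.
by exists (fun t => N t a b) => // t Dt; rewrite -NE // mxE.
Qed.

Lemma polyfun_polymap T (A : set (T -> K)) D d (m : T -> rep K Q d) :
    funalg A -> A D -> (forall i j (h : arr Q i j),
      mxin A (fun t => m t i j h)) ->
  ratmap A D (@polyfun K I Q d) m.
Proof.
move=> algA AD Am; apply: polyfun_ratmap => // i j h.
by exists (fun t => D t *: m t i j h) => //; exact: mxin_scale.
Qed.

(** One denominator serves all vertices: [D] times an inverse is the adjugate times the other
    determinants. Outside the support the matrices are empty, hence invertible. *)
Lemma family_inverse T (A : set (T -> K)) (e : dimv I) (M : T ->
  forall j, 'M[K]_(e j))
    (D := fun t => \prod_(j <- finsupp e) \det (M t j)) :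
    funalg A -> (forall j, mxin A (fun t => M t j)) ->
  [/\ A D, forall t j, D t != 0 -> M t j \in unitmx &
      forall j, exists2 N, mxin A N &
        forall t, D t != 0 -> D t *: invmx (M t j) = N t].
Proof.
move=> algA AM.
have unitM t j : D t != 0 -> M t j \in unitmx.
  case: (boolP (j \in finsupp e)) => je.
    by rewrite unitmxE unitfE /D prodf_seq_neq0 => /allP/(_ j je).
  move=> _; rewrite -row_free_unit -kermx_eq0; apply/eqP/matrixP => a.
  by case/negP: je; exact: dimv_gt0 a.
split=> // [|j]; first by apply: fa_prod => // j _; exact: fa_det.
case: (boolP (j \in finsupp e)) => je; last first.
  exists (fun=> 0) => [|t _]; first exact: mxin_cst.
  by apply/matrixP => a; case/negP: je; exact: dimv_gt0 a.
exists (fun t => (\prod_(k <- rem j (finsupp e)) \det (M t k)) *: \adj (M t j)).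
  apply: mxin_scale => //; last exact: mxin_adj.
  by apply: fa_prod => // k _; exact: fa_det.
move=> t Dt; have uM := unitM t j Dt.
rewrite /invmx uM /D (big_rem j je) /= scalerA mulrAC divff ?mul1r //.
by rewrite -unitfE -unitmxE.
Qed.

End GeneratedAlgebras.

(** * Irreducibility of isomorphism classes *)

Section Orbits.
Variables (K : numFieldType) (I : countType) (Q : quiver I).

Definition iso_rep d (B B' : rep K Q d) : Prop := exists b b' : forall j,
  'M[K]_(d j),
  [/\ forall j, b j *m b' j = 1%:M, forall j, b' j *m b j = 1%:M &
      forall j k (h : arr Q j k), B' j k h = b j *m B j k h *m b' k].

Lemma irr_orbit d (B0 : rep K Q d) : irr (@polyfun K I Q d) (iso_rep B0).
Proof.
apply: irr_rat_curve => B1 B2 [b1 [b1' [bb1 bb1' B1E]]] [b2 [b2' [bb2 bb2'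
  B2E]]].
(* [a] conjugates [B1] into [B2], and [M] is the line from the identity to [a]; it acts wherever its
   determinants are non-zero. *)
pose a j := b2 j *m b1' j; pose M t j := 1%:M + t *: (a j - 1%:M).
have algP := funalg_polyK K.
have AM j : mxin (@polyK K) (fun t => M t j).
  apply: mxin_add => //; first exact: mxin_cst.
  by apply: mxin_scale => //; [exact: polyK_id|exact: mxin_cst].
have [AD unitM invM] := family_inverse algP AM.
set D := (fun t => _) in AD unitM invM.
pose g t : rep K Q d := fun j k h => M t j *m B1 j k h *m invmx (M t k).
have M0 j : M 0 j = 1%:M by rewrite /M scale0r addr0.
have M1 j : M 1 j = a j by rewrite /M scale1r addrC subrK.
have ua j : a j *m (b1 j *m b2' j) = 1%:M.
  by rewrite /a -mulmxA (mulmxA (b1' j)) bb1' mul1mx bb2.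
exists D, g; split=> //.
- apply: polyfun_ratmap => // j k h; have [N AN NE] := invM k.
  exists (fun t => M t j *m B1 j k h *m N t).
    by apply: mxin_mul => //; apply: mxin_mul => //; exact: mxin_cst.
  by move=> t Dt; rewrite -NE // scalemxAr.
- split; rewrite /D.
    by rewrite big1 ?oner_eq0 // => j _; rewrite M0 det1.
  rewrite prodf_seq_neq0; apply/allP => j _ /=.
  by rewrite -unitfE -unitmxE M1; case/mulmx1_unit: (ua j).
- split; apply: rep_ext => j k h; rewrite /g.
    by rewrite !M0 invmx1 mul1mx mulmx1.
  rewrite !M1; have -> : invmx (a k) = b1 k *m b2' k.
    by have [uak _] := mulmx1_unit (ua k); rewrite -[LHS]mulmx1 -(ua k) mulKmx.
  rewrite B1E B2E /a -!mulmxA (mulmxA (b1' j)) bb1' mul1mx.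
  by rewrite (mulmxA (b1' k)) bb1' mul1mx.
- move=> t Dt; exists (fun j => M t j *m b1 j),
    (fun j => b1' j *m invmx (M t j)).
  split=> [j|j|j k h].
  + by rewrite mulmxA -(mulmxA (M t j)) bb1 mulmx1 mulmxV // unitM.
  + by rewrite mulmxA mulmxKV ?unitM // bb1'.
  + by rewrite /g B1E !mulmxA.
Qed.

End Orbits.

(** * Solving the off-diagonal moment map equation in families *)

Section Sections.
Variables (K : numClosedFieldType) (I : countType) (Q : quiver I).
Variables (d d' : dimv I) (i : I) (l : nat).
Hypothesis dE : forall j, d j = (d' j + (if j == i then l else 0))%N.

Local Notation frame := (@frame K I d d' i l).
Local Notation quotrep := (@quotrep K I Q l).
Local Notation mixrep := (@mixrep K I Q d' l).
Implicit Types (x : rep K Q d') (y : quotrep) (S : mixrep).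

Lemma sg_sq j k (h : arr Q j k) : sg K h * sg K h = 1.
Proof. by rewrite /sg; case: ifP; rewrite ?mulrNN mulr1. Qed.

Lemma bar_inj j k : injective (@bar I Q j k).
Proof. exact: can_inj (@barK I Q j k). Qed.

Lemma nu_linear x y a S S' :
  nu d i x y (fun j k h => a *: S j k h + S' j k h) =
  a *: nu d i x y S + nu d i x y S'.
Proof.
rewrite /nu scalerDr !scaler_sumr [RHS]addrACA -!big_split; congr (_ + _).
  apply: eq_bigr => k _; rewrite scaler_sumr -big_split;
    apply: eq_bigr => h _ /=.
  by rewrite mulmxDl -scalemxAl scalerDr !scalerA mulrC.
apply: eq_bigr => h _ /=.
by rewrite mulmxDr -scalemxAr scalerDr !scalerA mulrC.
Qed.

Lemma nu_eq0 x y : nu d i x y (fun j k h => 0) = 0.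
Proof.
rewrite /nu big1 ?add0r => [|k _]; last first.
  by rewrite big1 // => h _; rewrite mul0mx scaler0.
by rewrite big1 // => h _; rewrite mulmx0 scaler0.
Qed.

(* If [phi] is orthogonal to the image of [nu], then testing it against the
   conjugate transposes of [E h = x (bar h) phi - phi y (bar h)] shows that all
   [E h] vanish: [phi] kills the arrows into [i] and intertwines the loops, so
   it kills [W_ x i], which is everything. *)
Lemma nu_surj x y : eps_rep x i = 0%N -> forall M, exists S, nu d i x y S = M.
Proof.
move=> epsx; apply: (@subspace_full K l (d' i) [set M | exists S,
  nu d i x y S = M]).
  split=> [|a _ _ [S <-] [S' <-]]; last first.
    by exists (fun j k h => a *: S j k h + S' j k h); exact: nu_linear.
  by exists (fun j k h => 0); exact: nu_eq0.
move=> phi ortho.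
case: (boolP (i \in finsupp d)) => id; last first.
  apply/matrixP => a b; case/negP: id; rewrite mem_finsupp dE eqxx.
  by rewrite addn_eq0 negb_and orbC -lt0n (leq_ltn_trans _ (ltn_ord b)).
(* Extending [phi] by zero gives [E] one formula for loops and for the other arrows alike. *)
pose Phi k : 'M[K]_(d' k, l) := dfwith (fun k => 0 : 'M[K]_(d' k, l)) phi k.
have Phii : Phi i = phi by rewrite /Phi dfwith_in.
have Phi0 k : k != i -> Phi k = 0 by move=> ki;
  rewrite /Phi dfwith_out // eq_sym.
pose E j k (h : arr Q j k) := x k j (bar h) *m Phi j - Phi k *m y k j (bar h).
pose S : mixrep := fun j k h => sg K h *: (map_mx Num.conj (E j k h))^T.
(* The loop sum of [nu], reindexed along [bar] with a change of sign, supplies the terms of [E] that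
   involve [y]; the trace is then a sum of Hermitian square norms. *)
have trE : \tr (nu d i x y S *m phi) =
    \sum_(k <- finsupp d) \sum_(h : arr Q i k) \tr ((map_mx Num.conj (E i k
      h))^T *m E i k h).
  have -> : \sum_(k <- finsupp d) \sum_(h : arr Q i k)
        \tr ((map_mx Num.conj (E i k h))^T *m E i k h) =
      \sum_(k <- finsupp d) \sum_(h : arr Q i k)
        (sg K h * \tr (S i k h *m x k i (bar h) *m phi) -
         sg K h * \tr (S i k h *m Phi k *m y k i (bar h))).
    apply: eq_bigr => k _; apply: eq_bigr => h _.
    rewrite -mulrBr -raddfB -!mulmxA -mulmxBr -Phii -/(E i k h).
    by rewrite /S /= -scalemxAl mxtraceZ mulrA sg_sq mul1r.
  rewrite /nu mulmxDl raddfD /=.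
  under [in RHS]eq_bigr => k _ do rewrite sumrB.
  rewrite sumrB; congr (_ + _).
    rewrite mulmx_suml raddf_sum; apply: eq_bigr => k _ /=.
    rewrite mulmx_suml raddf_sum; apply: eq_bigr => h _ /=.
    by rewrite -scalemxAl mxtraceZ.
  rewrite mulmx_suml raddf_sum (bigD1_seq i) ?fset_uniq //=.
  rewrite [X in _ = - (_ + X)]big1 => [|k ki]; last first.
    by apply: big1 => h _; rewrite Phi0 // mulmx0 mul0mx mxtrace0 mulr0.
  rewrite addr0 -sumrN (reindex_inj (@bar_inj i i)); apply: eq_bigr => h _ /=.
  rewrite sg_bar barK -scalemxAl mxtraceZ mulNr; congr (- (_ * _)).
  by rewrite Phii -mulmxA mxtrace_mulC.
have E0 k (h : arr Q i k) : E i k h = 0.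
  case: (boolP (k \in finsupp d)) => kd; last first.
    apply/matrixP => a; case/negP: kd; apply: (finsupp_sub dE);
      exact: dimv_gt0 a.
  have := ortho _ (ex_intro _ S erefl); rewrite trE => /eqP.
  rewrite psumr_eq0; last first.
    by move=> k' _; apply: sumr_ge0 => h' _; exact: trace_conj_ge0.
  move=> /allP/(_ k kd) /=; rewrite psumr_eq0 => [|h' _];
    last exact: trace_conj_ge0.
  by move=> /allP/(_ h (mem_index_enum _)) /= /eqP /trace_conj_eq0.
have Wphi : (W_ x i <= kermx phi)%MS.
  apply: W_min => [|h].
    apply: in_image_min => j h ji; rewrite sub_kermx; apply/eqP.
    by have := E0 j (bar h); rewrite /E barK Phii Phi0 // mul0mx subr0.
  rewrite sub_kermx -mulmxA; have := E0 i (bar h).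
  rewrite /E barK Phii => /eqP; rewrite subr_eq0 => /eqP ->.
  by rewrite mulmxA mulmx_ker mul0mx.
have Wfull : row_full (W_ x i).
  by rewrite /row_full eqn_leq rank_leq_col -subn_eq0 -/(eps_rep x i) epsx.
apply/eqP; rewrite -[phi]mul1mx -sub_kermx; apply: submx_trans Wphi.
by rewrite sub1mx.
Qed.

(** The parameter space is abstract because [y] varies over a fixed [x] in [irr_fibre_in], while [x]
    varies under a fixed [y] in [stratum_section]. *)
Lemma nu_section T (A : set (T -> K)) (X : T -> rep K Q d') (Y : T ->
  quotrep) t0 S0 :
    funalg A -> (forall j k (h : arr Q j k), mxin A (fun t => X t j k h)) ->
    (forall j k (h : arr Q j k), mxin A (fun t => Y t j k h)) ->
    eps_rep (X t0) i = 0%N -> nu d i (X t0) (Y t0) S0 = 0 ->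
  exists S : T -> mixrep, [/\ forall j k (h : arr Q j k),
    mxin A (fun t => S t j k h),
    S t0 = S0 & forall t, nu d i (X t) (Y t) (S t) = 0].
Proof.
move=> algA AX AY eps0 nu0.
have [|k [v [c [Ac v0 c0 cL]]]] := @kernel_section K T mixrep A l (d' i)
    (fun t S => nu d i (X t) (Y t) S) t0 S0 algA _ nu0 (nu_surj _ eps0).
  move=> S; apply: mxin_add => //; apply: mxin_sum => // j _.
    apply: mxin_sum => // h _; apply: mxin_scale => //; first exact: fa_cst.
    by apply: mxin_mul => //; exact: mxin_cst.
  apply: mxin_scale => //; first exact: fa_cst.
  by apply: mxin_mul => //; exact: mxin_cst.
exists (fun t j k h => \sum_a c a t *: v a j k h); split.
- move=> j j' h; apply: mxin_sum => // a _; apply: mxin_scale => //.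
  exact: mxin_cst.
- do 3!apply: functional_extensionality_dep => ?.
  rewrite big_ord_recl c0 eqxx scale1r v0 big1 ?addr0 // => a _.
  by rewrite c0 scale0r.
- move=> t; rewrite -[RHS](cL t); move: (index_enum _) => r.
  elim: r => [|a r IHr].
    rewrite big_nil -(nu_eq0 (X t) (Y t)); congr (nu _ _ _ _ _).
    by do 3!apply: functional_extensionality_dep => ?; rewrite big_nil.
  rewrite big_cons -IHr -nu_linear; congr (nu _ _ _ _ _).
  by do 3!apply: functional_extensionality_dep => ?; rewrite big_cons.
Qed.

End Sections.

(** * Irreducibility of the triangular quotients *)

Section QuotientIrreducible.
Variables (K : numClosedFieldType) (I : countType) (Q : quiver I).

Lemma mxin_coords m n j k (h : arr Q j k) :
  mxin (genfun (@coords K I Q m n)) (fun B => B j k h).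
Proof. by move=> a b; apply: genfun_gen; exists j, k, h, a, b. Qed.

Lemma irr_lines m n (Y : set (forall j k, arr Q j k -> 'M[K]_(m j k, n j k))) :
  (forall y1 y2 t, Y y1 -> Y y2 ->
     Y (fun j k h => y1 j k h + t *: (y2 j k h - y1 j k h))) ->
  irr (genfun (@coords K I Q m n)) Y.
Proof.
move=> lineY; apply: irr_rat_curve => y1 y2 Yy1 Yy2.
exists (fun=> 1), (fun t j k h => y1 j k h + t *: (y2 j k h - y1 j k h)).
have algP := funalg_polyK K; split.
- exact: fa_cst.
- apply: genfun_polymap => // _ [j [k [h [a [b ->]]]]].
  apply: (_ : mxin _ (fun t => y1 j k h + t *: (y2 j k h - y1 j k h))) => //.
  apply: mxin_add => //; first exact: mxin_cst.
  by apply: mxin_scale => //; [exact: polyK_id|exact: mxin_cst].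
- by rewrite oner_eq0.
- split; do 3!apply: functional_extensionality_dep => ?.
    by rewrite scale0r addr0.
  by rewrite scale1r addrC subrK.
- by move=> t _; exact: lineY.
Qed.

Variables (d d' : dimv I) (i : I) (l : nat).
Local Notation quotrep := (@quotrep K I Q l).
Local Notation quotfun := (genfun (@coords K I Q (fun _ _ => l) (fun _ _ =>
  l))).
Implicit Types (x : rep K Q d') (y : quotrep).

Lemma fa_disc T (A : set (T -> K)) (X : T -> rep K Q d') (Y : T -> quotrep) :
  funalg A -> (forall h : arr Q i i, mxin A (fun t => X t i i h)) ->
  (forall h : arr Q i i, mxin A (fun t => Y t i i h)) ->
  A (fun t => disc i (X t) (Y t)).
Proof.
move=> algA AX AY; apply: fa_prod => // h _; apply: fa_mul => //.
  by apply: fa_prod => // ab _; apply: fa_sub => //; exact: AY.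
apply: fa_prod => // a _; apply: fa_det => //; apply: mxin_sub => //.
move=> b c; apply: (@fa_ext _ _ _ (fun t => Y t i i h a a * (b == c)%:R)).
  by apply: fa_mul => //; [exact: AY|exact: fa_cst].
by move=> t; rewrite mxE mulr_natr.
Qed.

Lemma eq_disc x y y' :
  (forall h : arr Q i i, ~~ inOmega h -> y i i h = y' i i h) ->
  disc i x y = disc i x y'.
Proof.
move=> yy'; apply: eq_bigr => h hO; congr (_ * _);
  by apply: eq_bigr => ? _; rewrite yy'.
Qed.

(** Pairing each loop with its opposite turns [kap] into a sum of commutators, linear in the loops
    of Omega once the others are fixed. *)
Lemma kapE y : kap i y = \sum_(h : arr Q i i | inOmega h)
  (y i i h *m y i i (bar h) - y i i (bar h) *m y i i h).
Proof.
rewrite /kap (bigID (fun h => inOmega h)) /= sumrB; congr (_ + _).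
  by apply: eq_bigr => h hO; rewrite /sg hO scale1r.
rewrite (reindex_inj (@bar_inj _ _ i i)) -sumrN /=.
apply: eq_big => [h|h]; first by rewrite Omega_bar negbK.
by rewrite Omega_bar negbK => hO; rewrite sg_bar barK /sg hO scaleN1r.
Qed.

Definition quot_base x : set quotrep := [set y |
  (forall h : arr Q i i, ~~ inOmega h ->
    is_trig_mx (y i i h)) /\ disc i x y != 0].

Lemma irr_quot_base x : irr quotfun (quot_base x).
Proof.
have algG := funalg_genfun (@coords K I Q (fun _ _ => l) (fun _ _ => l)).
apply: (@irr_open _ _ _ [set y : quotrep | forall h : arr Q i i, ~~ inOmega h ->
  is_trig_mx (y i i h)] (disc i x)) => //; last first.
  by apply: (@fa_disc quotrep _ (fun=> x) id) => // h;
    [exact: mxin_cst|exact: mxin_coords].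
apply: irr_lines => y1 y2 t trig1 trig2 h hO.
have /is_trig_mxP T1 := trig1 h hO; have /is_trig_mxP T2 := trig2 h hO.
by apply/is_trig_mxP => a b ab; rewrite !mxE T1 // T2 // subrr mulr0 addr0.
Qed.

(** Arrows of different types are compared as dependent pairs; on loops at [i] this is plain
    equality, since [I] has decidable equality. *)
Lemma loop_delta (h0 : arr Q i i) (s : 'M[K]_l) : exists v : quotrep,
  forall h : arr Q i i, v i i h = if h == h0 then s else 0.
Proof.
exists (fun j k h => if `[< existT (fun jk : I * I => arr Q jk.1 jk.2) (j,
  k) h =
  existT _ (i, i) h0 >] then s else 0).
move=> h; case: asboolP => [hh0|hh0]; last first.
  by case: eqP => // hE; case: hh0; rewrite hE.
have /(_ (@eq_comparable _)) -> := Eqdep_dec.inj_pair2_eq_dec _ _ _ _ _ _ hh0.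
by rewrite eqxx.
Qed.

(** Fibred over the loops outside Omega, which range over an open part of an affine space; the
    fibres are stable under lines. A base point carries arbitrary entries on the other arrows, which
    [over] ignores. *)
Lemma irr_quot x : irr quotfun [set y | quot_point i x y].
Proof.
have algG := funalg_genfun (@coords K I Q (fun _ _ => l) (fun _ _ => l)).
pose over y0 y := forall h : arr Q i i, ~~ inOmega h -> y i i h = y0 i i h.
apply: (@irr_fibration _ quotrep quotrep quotfun quotfun (quot_base x)
  [set y | quot_point i x y] over (@irr_quot_base x)); last first.
  move=> y0 Ty0; apply: irr_lines => y1 y2 t [[T1 k1 D1] o1] [[T2 k2 D2] o2].
  have o : over y0 (fun j k h => y1 j k h + t *: (y2 j k h - y1 j k h)).
    by move=> h hO; rewrite o1 // o2 // subrr scaler0 addr0.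
  split=> //; split.
  - move=> h; move: (T1 h) (T2 h); case: ifPn => hO.
      by move=> s1 s2 a b ab; rewrite !mxE s1 // s2 // subrr mulr0 addr0.
    by move=> s1 _; rewrite o // -o1.
  - transitivity (kap i y1 + t *: (kap i y2 - kap i y1)); last first.
      by rewrite k1 k2 subrr scaler0 addr0.
    rewrite !kapE -sumrB scaler_sumr -big_split; apply: eq_bigr => h hO /=.
    have hbar : ~~ inOmega (bar h) by rewrite Omega_bar hO.
    rewrite (o1 _ hbar) (o2 _ hbar) subrr scaler0 addr0.
    rewrite mulmxDl mulmxDr -scalemxAl -scalemxAr mulmxBl mulmxBr.
    set a1 := _ *m _; set a2 := _ *m _; set b1 := y0 i i _ *m _;
      set b2 := y0 i i _ *m _.
    by apply/matrixP => a b; rewrite !mxE; ring.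
  - by rewrite (@eq_disc x _ y1) // => h hO; rewrite o // o1.
move=> f y Af [Ty ky Dy] fy.
have y_base : quot_base x y.
  by split=> // h hO; move: (Ty h); rewrite (negPf hO).
(* Without a loop in Omega there is no loop at [i] at all, and [over] is vacuous. *)
case: (pickP (fun h : arr Q i i => inOmega h)) => [h0 h0O|noO]; last first.
  exists (fun=> 1); split; [exact: fa_cst| by exists y; rewrite ?oner_eq0|].
  move=> y0 _ _; exists y; split=> // h hO.
  by have := noO (bar h); rewrite Omega_bar hO.
(* As [kap] takes only strictly triangular values here, an auxiliary unknown [vw.2] fills the
   remaining entries and makes [L] surjective onto all matrices. *)
pose L y0 (vw : quotrep * 'M[K]_l) : 'M[K]_l :=
  \sum_(h : arr Q i i | inOmega h)
    (strict_part (vw.1 i i h) *m y0 i i (bar h) - y0 i i (bar h) *m strict_part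
      (vw.1 i i h))
  + (vw.2 - strict_part vw.2).
have [|||k [v [c [Ac v0 c0 cL]]]] :=
  @kernel_section K quotrep _ quotfun l l L y (y, 0) algG.
- move=> vw; apply: mxin_add => //; last exact: mxin_cst.
  apply: mxin_sum => // h _; apply: mxin_sub => //; apply: mxin_mul => //;
    by [exact: mxin_cst|exact: mxin_coords].
- rewrite /L /= linear0 subrr addr0 -[RHS]ky kapE; apply: eq_bigr => h hO.
  by rewrite strict_part_id //; move: (Ty h); rewrite hO.
(* A single loop [h0] suffices: its commutator with the regular triangular [y (bar h0)] is handled
   by [ad_strict_surj]. *)
- move=> N; have h0bar : ~~ inOmega (bar h0) by rewrite Omega_bar h0O.
  have [inj_y _] := (disc_neq0 i x y).1 Dy _ h0bar.
  have ty : is_trig_mx (y i i (bar h0)) by move: (Ty (bar h0));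
    rewrite (negPf h0bar).
  have [s sN] := ad_strict_surj N ty inj_y.
  have [w wE] := loop_delta h0 s; exists (w, s).
  rewrite /L /= (bigD1 h0) //= wE eqxx big1 ?addr0 // => h /andP[hO hh0].
  by rewrite wE (negPf hh0) linear0 mul0mx mulmx0 subrr.
pose g y0 : quotrep := fun j k h => if [&& inOmega h, j == i & k == i]
  then strict_part (\sum_a c a y0 *: (v a).1 j k h) else y0 j k h.
have Ag j k' (h : arr Q j k') : mxin quotfun (fun y0 => g y0 j k' h).
  rewrite /g; case: [&& _, _ & _]; last exact: mxin_coords.
  have AS : mxin quotfun (fun y0 => \sum_a c a y0 *: (v a).1 j k' h).
    by apply: mxin_sum => // a _; apply: mxin_scale => //; exact: mxin_cst.
  move=> a b; case ba : (b < a)%N.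
    by apply: fa_ext (AS a b) _ => t; rewrite /strict_part [RHS]mxE ba.
  by apply: fa_ext (fa_cst algG 0) _ => t; rewrite /strict_part [RHS]mxE ba.
have gy : g y = y.
  apply: functional_extensionality_dep => j;
    apply: functional_extensionality_dep => k'.
  apply: functional_extensionality_dep => h; rewrite /g.
  case: ifP => // /and3P[hO /eqP ji /eqP ki]; subst j k'.
  rewrite big_ord_recl c0 eqxx scale1r v0 big1 => [|a _]; last first.
    by rewrite c0 scale0r.
  by rewrite addr0 strict_part_id //; move: (Ty h); rewrite hO.
have rat_g : ratmap quotfun (fun=> 1) quotfun g.
  apply: genfun_polymap => // _ [j [k' [h [a [b ->]]]]].
  exact: Ag.
have [f' Af' f'E] := ratmap_pullback algG (fa_cst algG 1) rat_g Af.
exists f'; split=> //; first by exists y; rewrite // f'E oner_eq0 gy.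
move=> y0 [T0 D0]; rewrite f'E oner_eq0 /= => fg; exists (g y0).
have g_over : over y0 (g y0) by move=> h hO; rewrite /g (negPf hO).
have gT : triangular i (g y0).
  move=> h; case: ifPn => hO; last by rewrite g_over // T0.
  by rewrite /g hO !eqxx; exact: strict_partP.
split=> //; split=> //; last by rewrite (@eq_disc x _ y0).
(* Taking strict parts removes the auxiliary unknown and keeps [kap], which is strictly triangular
   on triangular families. *)
transitivity (strict_part (\sum_a c a y0 *: L y0 (v a)));
  last by rewrite cL linear0.
have -> : \sum_a c a y0 *: L y0 (v a) = kap i (g y0) +
    (\sum_a c a y0 *: (v a).2 - strict_part (\sum_a c a y0 *: (v a).2)).
  rewrite kapE linear_sum -sumrB /=.
  under eq_bigr => a _ do rewrite /L scalerDr scaler_sumr.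
  rewrite big_split /= exchange_big /=; congr (_ + _); last first.
    by apply: eq_bigr => a _; rewrite linearZ scalerBr.
  apply: eq_bigr => h hO; have hbar : ~~ inOmega (bar h) by rewrite Omega_bar
    hO.
  rewrite (g_over _ hbar) {1 2}/g hO !eqxx /= linear_sum mulmx_suml mulmx_sumr
    -sumrB.
  apply: eq_bigr => a _.
  by rewrite linearZ /= -scalemxAl -scalemxAr -scalerBr.
rewrite linearD linearB /= [strict_part (strict_part _)]strict_part_id;
  last exact: strict_partP.
rewrite subrr addr0 strict_part_id // kapE => a b ab.
rewrite summxE big1 // => h hO; have hbar : ~~ inOmega (bar h) by rewrite
  Omega_bar hO.
have sh : strict_trig (g y0 i i h) by move: (gT h); rewrite hO.
have th : is_trig_mx (g y0 i i (bar h)) by move: (gT (bar h));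
  rewrite (negPf hbar).
by apply: (strict_trigB _ _ ab);
  [exact: strict_trig_mull|exact: strict_trig_mulr].
Qed.

End QuotientIrreducible.

(** * Irreducibility of the set of extensions of a given restriction *)

Section Fibres.
Variables (K : numClosedFieldType) (I : countType) (Q : quiver I).
Variables (d d' : dimv I) (i : I) (l : nat).
Hypothesis dE : forall j, d j = (d' j + (if j == i then l else 0))%N.

Local Notation frame := (@frame K I d d' i l).
Local Notation quotrep := (@quotrep K I Q l).
Local Notation mixrep := (@mixrep K I Q d' l).
Local Notation quotfun := (genfun (@coords K I Q (fun _ _ => l) (fun _ _ =>
  l))).
Implicit Types (x : rep K Q d') (y : quotrep) (S : mixrep) (B : rep K Q d).

Lemma mxin_form T (A : set (T -> K)) (fr : frame) (X : T -> rep K Q d')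
    (Y : T -> quotrep) (S : T -> mixrep) j k (h : arr Q j k) :
    funalg A -> mxin A (fun t => X t j k h) -> mxin A (fun t => Y t j k h) ->
    mxin A (fun t => S t j k h) ->
  mxin A (fun t => form fr (X t) (Y t) (S t) h).
Proof.
move=> algA AX AY AS; apply: mxin_add => //.
  by apply: mxin_mul => //; [apply: mxin_mul => //|]; exact: mxin_cst.
apply: mxin_mul => //; first exact: mxin_cst.
by apply: mxin_add => //; apply: mxin_mul => //; exact: mxin_cst.
Qed.

Definition fibre_in (fr : frame) x : set (rep K Q d) := [set B |
  exists y S, [/\ B = form fr x y S, quot_point i x y & nu d i x y S = 0]].

Definition fibre x : set (rep K Q d) := [set B | exists fr, fibre_in fr x B].

(** With the splitting fixed, this is a family over the quotient points whose fibres are the linear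
    spaces of solutions [S]. *)
Lemma irr_fibre_in fr x : eps_rep x i = 0%N ->
  irr (@polyfun K I Q d) (fibre_in fr x).
Proof.
move=> epsx; have algG := funalg_genfun (@coords K I Q (fun _ _ => l) (fun _ _
  => l)).
have algP := funalg_polyK K.
apply: (@irr_fibration _ quotrep (rep K Q d) quotfun _ [set y | quot_point i x
  y] _
  (fun y B => exists2 S, B = form fr x y S & nu d i x y S = 0) (@irr_quot _ _ _
    _ _ _ x)).
- move=> f B Pf [y [S [BE qy nu0]]] fB.
  have [S' [AS S'y nuS]] := @nu_section K I Q d d' i l dE quotrep quotfun
    (fun=> x) id y S
    algG (fun j k h => mxin_cst algG _) (@mxin_coords _ _ _ _ _) epsx nu0.
  have rat : ratmap quotfun (fun=> 1) (@polyfun K I Q d) (fun y => form fr x y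
    (S' y)).
    apply: polyfun_polymap => //; first exact: fa_cst.
    move=> j k h; apply: mxin_form => //; first exact: mxin_cst.
    exact: mxin_coords.
  have [f' Af' f'E] := ratmap_pullback algG (fa_cst algG 1) rat Pf.
  exists f'; split=> //; first by exists y => //; rewrite f'E oner_eq0 S'y -BE.
  move=> y' qy'; rewrite f'E oner_eq0 /= => fy'.
  exists (form fr x y' (S' y')); split=> //; last by exists (S' y').
  by exists y', (S' y').
- move=> y qy; apply: irr_rat_curve => B1 B2 [_ [S1 B1E n1]] [_ [S2 B2E n2]].
  pose S t : mixrep := fun j k h => t *: (S2 j k h - S1 j k h) + S1 j k h.
  have nuS t : nu d i x y (S t) = 0.
    rewrite nu_linear; have -> : nu d i x y (fun j k h => S2 j k h - S1 j k h)
      = 0.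
      have := nu_linear d i x y (-1) S1 S2; rewrite n1 n2 scaler0 addr0 => <-.
      congr (nu _ _ _ _ _); do 3!apply: functional_extensionality_dep => ?.
      by rewrite scaleN1r addrC.
    by rewrite scaler0 add0r.
  exists (fun=> 1), (fun t => form fr x y (S t)); split.
  + exact: fa_cst.
  + apply: polyfun_polymap => // [|j k h]; first exact: fa_cst.
    apply: mxin_form => //; try exact: mxin_cst.
    apply: mxin_add => //; last exact: mxin_cst.
    by apply: mxin_scale => //; [exact: polyK_id|exact: mxin_cst].
  + by rewrite oner_eq0.
  + rewrite B1E B2E; split; apply: (f_equal (form fr x y));
      do 3!apply: functional_extensionality_dep => ?; rewrite /S.
      by rewrite scale0r add0r.
    by rewrite scale1r subrK.
  + by move=> t _; split; [exists y, (S t)|exists (S t)].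
Qed.

Lemma frame_iso (fr : frame) (b b' : forall j, 'M[K]_(d j)) :
  (forall j, b j *m b' j = 1%:M) -> (forall j, b' j *m b j = 1%:M) ->
  exists fr' : frame, forall x y S j k (h : arr Q j k),
    form fr' x y S h = b j *m form fr x y S h *m b' k.
Proof.
move=> bb' b'b; unshelve eexists (@Frame K I d d' i l (fun j => b j *m fp fr j)
  (fun j => fg fr j *m b' j) (fun j => fu fr j *m b' j) (fun j => b j *m fq fr
    j)
  _ _ _ _ _ _ _).
- by move=> j; rewrite mulmxA -(mulmxA (fg fr j)) b'b mulmx1 fgp.
- by move=> j; rewrite !mulmxA -mulmxDl -!(mulmxA (b j)) -mulmxDr fpgqu mulmx1
    bb'.
- by move=> j; rewrite mulmxA -(mulmxA (fg fr j)) b'b mulmx1 fgq.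
- by move=> j; rewrite mulmxA -(mulmxA (fu fr j)) b'b mulmx1 fup.
- by move=> j; rewrite mulmxA -(mulmxA (fu fr j)) b'b mulmx1 fuq.
- by move=> j ji /=; rewrite fq0 // mulmx0.
- by move=> j ji /=; rewrite fu0 // mul0mx.
move=> x y S j k h; rewrite /form /=.
by rewrite !(mulmxDr, mulmxDl) !mulmxA.
Qed.

(** Any two splittings differ by a graded automorphism, so [fibre] is swept out from [fibre_in] of
    one splitting by isomorphisms. *)
Lemma form_frames (fr fr' : frame) : exists b b' : forall j, 'M[K]_(d j),
  [/\ forall j, b j *m b' j = 1%:M, forall j, b' j *m b j = 1%:M &
      forall x y S j k (h : arr Q j k),
        form fr' x y S h = b j *m form fr x y S h *m b' k].
Proof.
pose b (f1 f2 : frame) j := fp f2 j *m fg f1 j + fq f2 j *m fu f1 j.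
have gb f1 f2 j : fg f1 j *m b f2 f1 j = fg f2 j.
  by rewrite mulmxDr !mulmxA fgp fgq mul1mx mul0mx addr0.
have ub f1 f2 j : fu f1 j *m b f2 f1 j = fu f2 j.
  rewrite mulmxDr !mulmxA fup fuq mul0mx add0r mul_scalar_mx.
  by have [_|ji] := eqVneq j i; rewrite ?scale1r // fu0 // scaler0.
have inv f1 f2 j : b f1 f2 j *m b f2 f1 j = 1%:M.
  by rewrite {1}/b mulmxDl -!mulmxA gb ub fpgqu.
exists (b fr fr'), (b fr' fr); split=> [j|j|x y S j k h]; rewrite ?inv //.
have -> : b fr fr' j *m form fr x y S h = fp fr' j *m (x j k h *m fg fr k) +
    fq fr' j *m (S j k h *m fg fr k + y j k h *m fu fr k).
  rewrite {1}/b mulmxDl -!mulmxA g_form u_form.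
  by have [_|ji] := eqVneq j i; rewrite ?scale1r // fq0 // !mul0mx.
by rewrite mulmxDl -!mulmxA mulmxDl -!mulmxA gb ub /form -!mulmxA.
Qed.

Lemma irr_fibre x : eps_rep x i = 0%N -> irr (@polyfun K I Q d) (fibre x).
Proof.
(* A reference splitting is read off a point of [fibre x], which the definition of [irr]
   provides. *)
move=> epsx; suff H (fr : frame) : irr (@polyfun K I Q d) (fibre x).
  move=> f g Pf Pg ex1 ex2; case: (ex1) => B [fr _] _.
  exact: (H fr f g Pf Pg ex1 ex2).
apply: (@irr_fibration _ _ _ _ _ _ _ (fun B0 B => iso_rep B0 B) (@irr_fibre_in
  fr x epsx)).
- move=> f B Pf [fr' [y [S [BE qy nu0]]]] fB.
  have [b [b' [bb' b'b conj]]] := form_frames fr fr'.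
  have algP := funalg_polyfun K Q d.
  have rat : ratmap (@polyfun K I Q d) (fun=> 1) (@polyfun K I Q d)
      (fun B0 j k h => b j *m B0 j k h *m b' k).
    apply: polyfun_polymap => //; first exact: fa_cst.
    move=> j k h; apply: mxin_mul => //; last exact: mxin_cst.
    by apply: mxin_mul => //; [exact: mxin_cst | move=> a c;
      exact: polyfun_coord].
  have [f' Af' f'E] := ratmap_pullback algP (fa_cst algP 1) rat Pf.
  exists f'; split=> //.
    exists (form fr x y S); first by exists y, S.
    rewrite f'E oner_eq0 /=; move: fB; rewrite BE.
    by have -> : form fr' x y S = (fun j k h => b j *m form fr x y S h *m b' k)
      by apply: rep_ext => j k h; exact: conj.
  move=> _ [y' [S'' [-> qy' nu']]]; rewrite f'E oner_eq0 /= => fB'.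
  eexists; split; last exact: fB'; last by exists b, b'.
  exists fr', y', S''; split=> //.
  by apply: rep_ext => j k h; rewrite conj.
- move=> B0 [y [S [B0E qy nu0]]].
  suff -> : [set B | fibre x B /\ iso_rep B0 B] = iso_rep B0 by exact:
    irr_orbit.
  apply/seteqP; split=> [B [] //|B /= [b [b' [bb' b'b BE]]]]; split;
    last by exists b, b'.
  have [fr' fr'E] := frame_iso fr bb' b'b.
  exists fr', y, S; split=> //; apply: rep_ext => j k h.
  by rewrite BE B0E fr'E.
Qed.

End Fibres.

(** * The restriction correspondence in both directions *)

Section Strata.
Variables (K : numClosedFieldType) (I : countType) (Q : quiver I).
Variables (d d' : dimv I) (i : I) (l : nat).
Hypothesis dE : forall j, d j = (d' j + (if j == i then l else 0))%N.

Local Notation restr := (fun (B : rep K Q d) (x : rep K Q d') =>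
  iso_restriction B (W_family i B) x).
Implicit Types (x : rep K Q d') (B : rep K Q d).

Lemma fibreP x B : N_ d' x -> eps_rep x i = 0%N ->
  fibre i l x B <-> N_ d B /\ restr B x.
Proof.
move=> Nx epsx; split=> [[fr [y [S [-> qy nu0]]]]|[NB Bx]].
  by have [] := construction dE fr Nx epsx qy nu0.
by have [fr [y [S [? ? ?]]]] := decomposition dE NB Bx; exists fr, y, S.
Qed.

Lemma restrict_N B x : N_ d B -> restr B x -> N_ d' x /\ eps_rep x i = 0%N.
Proof.
move=> NB /(restriction_frame dE)[fr gW gB]; split.
  exact: restriction_N dE _ _ _ NB gB.
exact: restriction_eps gW gB.
Qed.

(** The splitting and [y] stay fixed while [S] follows [x'] by [nu_section]; [y] remains admissible
    as long as [disc x' y] is non-zero. *)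
Lemma stratum_section f B x : polyfun f -> N_ d B -> restr B x -> f B != 0 ->
  exists f', [/\ polyfun f', f' x != 0 & forall x', N_ d' x' ->
    eps_rep x' i = 0%N ->
    f' x' != 0 -> exists B', [/\ N_ d B', restr B' x' & f B' != 0]].
Proof.
move=> Pf NB Bx fB; have [_ epsx] := restrict_N NB Bx.
have [fr [y [S [BE qy nu0]]]] := decomposition dE NB Bx.
have algP := funalg_polyfun K Q d'.
have Pid j k (h : arr Q j k) : mxin (@polyfun K I Q d') (fun x => x j k h).
  by move=> a b; exact: polyfun_coord.
have [S' [AS S'x nuS]] := @nu_section K I Q d d' i l dE _ _ id (fun=> y) x S
  algP Pid (fun j k h => mxin_cst algP _) epsx nu0.
pose D x' := disc i x' y.
have PD : polyfun D by apply: (@fa_disc _ _ _ _ _ _ _ _ id (fun=> y)) => // h;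
  exact: mxin_cst.
have rat : ratmap (@polyfun K I Q d') D (@polyfun K I Q d) (fun x => form fr x
  y (S' x)).
  apply: polyfun_polymap => // j k h; apply: mxin_form => //; exact: mxin_cst.
have [f' Pf' f'E] := ratmap_pullback algP PD rat Pf.
have [yT ky Dx] := qy; exists f'; split=> //; first by rewrite f'E S'x -BE Dx.
move=> x' Nx' epsx'; rewrite f'E => /andP[Dx' fx'];
  exists (form fr x' y (S' x')).
by have [] := construction dE fr Nx' epsx' (And3 yT ky Dx') (nuS x').
Qed.

Definition stratum (R : set (rep K Q d')) : set (rep K Q d) :=
  [set B | N_ d B /\ exists2 x, R x & restr B x].

Lemma irr_stratum (R : set (rep K Q d')) :
  (forall x, R x -> N_ d' x /\ eps_rep x i = 0%N) ->
    irr (@polyfun K I Q d') R ->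
  irr (@polyfun K I Q d) (stratum R).
Proof.
move=> RN irrR; apply: (@irr_fibration _ _ _ _ _ R _ (fun x B => restr B x)
  irrR).
- move=> f B Pf [NB [x Rx Bx]] fB.
  have [f' [Pf' f'x sec]] := stratum_section Pf NB Bx fB.
  exists f'; split=> // [|x' Rx' f'x']; first by exists x.
  have [Nx' epsx'] := RN _ Rx'; have [B' [NB' Bx' fB']] := sec _ Nx' epsx' f'x'.
  by exists B'; split=> //; split=> //; exists x'.
- move=> x Rx; have [Nx epsx] := RN x Rx.
  suff -> : [set B | stratum R B /\ restr B x] = fibre i l x by exact:
    irr_fibre.
  apply/seteqP; split=> [B [[NB _] Bx]|B /(fibreP B Nx epsx)[NB Bx]].
    exact/fibreP.
  by split=> //; split=> //; exists x.
Qed.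

Lemma restr_unique B x1 x2 : restr B x1 -> restr B x2 -> iso_rep x1 x2.
Proof.
move=> [g1 [f1 W1 gB1]] [g2 [f2 W2 gB2]].
have s12 j : (g1 j <= g2 j)%MS by rewrite W1 W2.
have s21 j : (g2 j <= g1 j)%MS by rewrite W1 W2.
exists (fun j => g2 j *m pinvmx (g1 j)), (fun j => g1 j *m pinvmx (g2 j));
  split.
- by move=> j; rewrite mulmxA mulmxKpV // mulmxVp.
- by move=> j; rewrite mulmxA mulmxKpV // mulmxVp.
move=> j k h; rewrite mulmxA -(mulmxA (_ *m _) (x1 j k h)) gB1 mulmxA mulmxKpV
  //.
by rewrite -gB2 -mulmxA mulmxVp // mulmx1.
Qed.

Lemma restr_iso B x1 x2 : restr B x1 -> iso_rep x1 x2 -> restr B x2.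
Proof.
move=> [g [f W gB]] [b [b' [bb' b'b xE]]].
have bfull j : row_full (b j) by apply/row_fullP; exists (b' j).
have bfree j : row_free (b j) by apply/row_freeP; exists (b' j).
exists (fun j => b j *m g j); split=> [j|j|j k h].
- by rewrite /row_free mxrankMfree // (eqP (bfree j)).
- by apply: eqmx_trans (W j); exact: eqmxMfull.
by rewrite xE -!mulmxA (mulmxA (b' k)) b'b mul1mx gB.
Qed.

(** A basis of [W_ B i] extends to polynomial families of vectors in [W_ B' i]. While these stay
    independent, the equality of dimensions makes them a basis in which to restrict [B']. *)
Lemma restriction_section f B x : polyfun f -> restr B x -> f x != 0 ->
  exists f', [/\ polyfun f', f' B != 0 & forall B', eps_rep B' i = l ->
    f' B' != 0 -> exists x', restr B' x' /\ f x' != 0].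
Proof.
move=> Pf Bx fx; have [fr gW gB] := restriction_frame dE Bx.
have algP := funalg_polyfun K Q d.
have /choice[w wP] : forall a : 'I_(d' i), exists w : rep K Q d -> 'rV_(d i),
    [/\ mxin (@polyfun K I Q d) w, forall B', (w B' <= W_ B' i)%MS &
        w B = row a (fg fr i)].
  by move=> a; apply: W_section; rewrite -gW row_sub.
pose Gi B' : 'M[K]_(d' i, d i) := \matrix_a w a B'.
pose G B' j : 'M[K]_(d' j, d j) := dfwith (fg fr) (Gi B') j.
have PG j : mxin (@polyfun K I Q d) (fun B' => G B' j).
  have [ij|ij] := eqVneq i j; last first.
    move=> a b; apply: fa_ext (fa_cst algP (fg fr j a b)) _ => B'.
    by rewrite /G dfwith_out.
  subst j; move=> a b; have [Pw _ _] := wP a.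
  by apply: fa_ext (Pw 0 b) _ => B'; rewrite /G dfwith_in /Gi mxE.
have GB j : G B j = fg fr j.
  have [ij|ij] := eqVneq i j; last by rewrite /G dfwith_out.
  subst j; rewrite /G dfwith_in; apply/row_matrixP => a; rewrite rowK.
  by have [_ _ ->] := wP a.
have GW B' j : (G B' j <= W_family i B' j)%MS.
  rewrite /W_family; have [ji|_] := eqVneq j i; last exact: submx1.
  subst j; rewrite /G dfwith_in; apply/row_subP => a; rewrite rowK.
  by have [_ + _] := wP a; apply.
pose M B' j := G B' j *m fp fr j.
have PM j : mxin (@polyfun K I Q d) (fun B' => M B' j).
  by apply: mxin_mul => //; exact: mxin_cst.
have [PD unitM invM] := family_inverse algP PM.
set D := (fun t => _) in PD unitM invM.
(* [fp fr k *m invmx (M B' k)] is a right inverse of [G B' k], so it reads coordinates in the basis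
   [G B' k]. *)
pose X B' : rep K Q d' := fun j k h =>
  G B' j *m B' j k h *m fp fr k *m invmx (M B' k).
have rat : ratmap (@polyfun K I Q d) D (@polyfun K I Q d') X.
  apply: polyfun_ratmap => // j k h; have [N PN NE] := invM k.
  exists (fun B' => G B' j *m B' j k h *m fp fr k *m N B').
    apply: mxin_mul => //; apply: mxin_mul => //; last exact: mxin_cst.
    by apply: mxin_mul => // a b; exact: polyfun_coord.
  by move=> B' DB'; rewrite -NE // scalemxAr.
have [f' Pf' f'E] := ratmap_pullback algP PD rat Pf; exists f'; split=> //.
  rewrite f'E; apply/andP; split.
    by rewrite /D big1 ?oner_eq0 // => j _; rewrite /M GB fgp det1.
  suff -> : X B = x by [].
  apply: rep_ext => j k h; rewrite /X /M !GB fgp invmx1 mulmx1 gB.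
  by rewrite -mulmxA fgp mulmx1.
move=> B' epsB'; rewrite f'E => /andP[DB' fX]; exists (X B'); split=> //.
have freeG j : row_free (G B' j).
  apply/row_freeP; exists (fp fr j *m invmx (M B' j)).
  by rewrite mulmxA mulmxV // unitM.
have GWE j : (G B' j :=: W_family i B' j)%MS.
  apply/eqmxP; rewrite GW /= -(mxrank_leqif_sup (GW B' j)) (eqP (freeG j)).
  rewrite /W_family; have := dE j; have [ji|ji] := eqVneq j i; last first.
    by rewrite mxrank1 addn0 => ->.
  subst j; move: epsB'; rewrite /eps_rep.
  have := rank_leq_col (W_ B' i); move: (\rank _) => r; lia.
exists (G B'); split=> // j k h.
have /submxP[c cE] : (G B' j *m B' j k h <= G B' k)%MS.
  by rewrite GWE (submx_trans _ (W_family_stable i B' h)) // submxMr.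
rewrite /X cE -!mulmxA; congr (_ *m _); rewrite !mulmxA -/(M B' k).
by rewrite mulmxV ?mul1mx // unitM.
Qed.

(** The same correspondence as in [irr_stratum] with base and total space exchanged; now each fibre
    is a single orbit. *)
Lemma irr_restrictions (X : set (rep K Q d)) :
  (forall B, X B -> eps_rep B i = l) -> irr (@polyfun K I Q d) X ->
  irr (@polyfun K I Q d') [set x | exists2 B, X B & restr B x].
Proof.
move=> Xl irrX; apply: (@irr_fibration _ _ _ _ _ X _ (fun B x => restr B x)
  irrX).
- move=> f x Pf [B XB Bx] fx.
  have [f' [Pf' f'B sec]] := restriction_section Pf Bx fx.
  exists f'; split=> // [|B' XB' f'B']; first by exists B.
  have [x' [Bx' fx']] := sec B' (Xl _ XB') f'B'.
  by exists x'; split=> //; exists B'.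
- move=> B XB; have [x Bx] := restriction_exists dE (Xl _ XB).
  suff -> : [set x | (exists2 B, X B & restr B x) /\ restr B x] = iso_rep x.
    exact: irr_orbit.
  apply/seteqP; split=> [x' [_ Bx']|x' xx']; first exact: restr_unique Bx Bx'.
  have Bx' := restr_iso Bx xx'.
  by split=> //; exists B.
Qed.

End Strata.

(** * Irreducible components and the crystal *)

Section Components.
Variables (K : numClosedFieldType) (I : countType) (Q : quiver I).

Definition vanishing_closure d (Y : set (rep K Q d)) : set (rep K Q d) :=
  [set B | forall f, polyfun f -> (forall y, Y y -> f y = 0) -> f B = 0].

Lemma zclosure_vanishing d (Y : set (rep K Q d)) :
  zclosure Y `<=` vanishing_closure Y.
Proof.
move=> B; apply; split; last by move=> y Yy f _; exact.
exists [set f | polyfun f /\ forall y, Y y -> f y = 0]; first by move=> f [].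
apply/seteqP; split=> B' H f; first by move=> []; exact: H.
by move=> Pf fY; apply: H.
Qed.

Lemma sub_zclosure d (Y : set (rep K Q d)) : Y `<=` zclosure Y.
Proof. by move=> B YB Z [_]; apply. Qed.

Lemma zclosed_zeros d (f : rep K Q d -> K) : polyfun f ->
  zclosed [set B | f B = 0].
Proof.
move=> Pf; exists [set f]; first by move=> _ ->.
by apply/seteqP; split=> B /=; [move=> fB _ -> | apply].
Qed.

Lemma zirreducible_irr d (Y : set (rep K Q d)) : zirreducible Y ->
  irr (@polyfun K I Q d) Y.
Proof.
move=> [_ Yirr] f g Pf Pg [y1 Yy1 fy1] [y2 Yy2 gy2]; apply: contrapT => no.
have [|H|H] := Yirr _ _ (zclosed_zeros Pf) (zclosed_zeros Pg).
- move=> y Yy /=; have [fy|fy] := eqVneq (f y) 0; first by left.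
  have [gy|gy] := eqVneq (g y) 0; first by right.
  by case: no; exists y.
- by move: fy1; rewrite (H _ Yy1) eqxx.
- by move: gy2; rewrite (H _ Yy2) eqxx.
Qed.

Lemma irr_zirreducible d (Y : set (rep K Q d)) : Y !=set0 ->
  irr (@polyfun K I Q d) Y -> zirreducible Y.
Proof.
move=> Y0 irrY; split=> // _ _ [S1 PS1 ->] [S2 PS2 ->] YZ.
apply: contrapT => /not_orP[/existsNP[y1 /not_implyP[Yy1 /existsNP[f
  /not_implyP[Sf fy1]]]]
  /existsNP[y2 /not_implyP[Yy2 /existsNP[g /not_implyP[Sg gy2]]]]].
have [||y [Yy fy gy]] := irrY f g (PS1 _ Sf) (PS2 _ Sg).
- by exists y1 => //; apply/eqP.
- by exists y2 => //; apply/eqP.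
by have [/(_ f Sf)|/(_ g Sg)] := YZ y Yy => /eqP; apply/negP.
Qed.

Lemma irr_dense d (X Y : set (rep K Q d)) : X `<=` Y ->
  Y `<=` vanishing_closure X ->
  irr (@polyfun K I Q d) X -> irr (@polyfun K I Q d) Y.
Proof.
move=> XY YX irrX f g Pf Pg [y1 Yy1 fy1] [y2 Yy2 gy2].
have dense h y : polyfun h -> Y y -> h y != 0 -> exists2 x, X x & h x != 0.
  move=> Ph Yy hy; apply: contrapT => no; move: hy; rewrite (YX y Yy) ?eqxx //.
  by move=> x Xx; apply/eqP; apply: contrapT => /negP hx; case: no; exists x.
have [||y [Xy fy gy]] := irrX f g Pf Pg.
- exact: dense fy1.
- exact: dense gy2.
by exists y; split=> //; exact: XY.
Qed.

Lemma generic_dense d (L T : set (rep K Q d)) : irr (@polyfun K I Q d) L ->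
  generic_on L T ->
  [/\ (L `&` T) !=set0, irr (@polyfun K I Q d) (L `&` T) &
      L `<=` vanishing_closure (L `&` T)].
Proof.
move=> irrL [Z [[S PS ->] /existsNP[B /not_implyP[LB /existsNP[z /not_implyP[Sz
  zB]]]] LZT]].
(* One equation [z] of [Z] that is not identically zero on [L] is enough: it cuts out a principal
   open subset on which [T] holds. *)
have zT y : L y -> z y != 0 -> T y.
  by move=> Ly zy; apply: LZT; split=> // /(_ z Sz) /eqP; apply/negP.
have {}zB : z B != 0 by apply/eqP.
split; first by exists B; split=> //; exact: zT.
  move=> f g Pf Pg [y1 [Ly1 Ty1] fy1] [y2 [Ly2 Ty2] gy2].
  have algP := funalg_polyfun K Q d.
  have [||y [Ly fy gy]] := irrL f g Pf Pg; [by exists y1|by exists y2|].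
  have [||y' [Ly' + zy']] := irrL (fun y => f y * g y) z (fa_mul algP Pf Pg)
    (PS _ Sz).
  - by exists y; rewrite ?mulf_neq0.
  - by exists B.
  rewrite mulf_eq0 negb_or => /andP[fy' gy'].
  by exists y'; split=> //; split=> //; exact: zT.
move=> y Ly f Pf fLT; apply/eqP; apply: contrapT => /negP fy.
have [||y' [Ly' fy' zy']] := irrL f z Pf (PS _ Sz); [by exists y|by exists B|].
by move: fy'; rewrite fLT ?eqxx //; split=> //; exact: zT.
Qed.

(** The generic value comes from the maximal rank of [W_] on [L], which is attained on an open
    subset because bases of [W_] extend to polynomial families. *)
Lemma generic_eps d i (L : set (rep K Q d)) : L !=set0 ->
  exists l, generic_on L [set B | eps_rep B i = l].
Proof.
move=> [B0 LB0]; pose P r := `[< exists2 B, L B & \rank (W_ B i) = r >].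
have exP : exists r, P r by exists (\rank (W_ B0 i)); apply/asboolP; exists B0.
have ubP r : P r -> (r <= d i)%N by move=> /asboolP[B _ <-];
  exact: rank_leq_col.
case: (ex_maxnP exP ubP) => r /asboolP[B LB rB] maxr; exists (d i - r)%N.
have [g freeg gW] := row_free_basis rB.
have algP := funalg_polyfun K Q d.
have /choice[w wP] : forall a : 'I_r, exists w : rep K Q d -> 'rV_(d i),
    [/\ mxin (@polyfun K I Q d) w, forall B',
      (w B' <= W_ B' i)%MS & w B = row a g].
  by move=> a; apply: W_section; rewrite -gW row_sub.
pose G B' : 'M[K]_(r, d i) := \matrix_a w a B'.
have GW B' : (G B' <= W_ B' i)%MS.
  by apply/row_subP => a; rewrite rowK; have [_ + _] := wP a; apply.
have PG : mxin (@polyfun K I Q d) G.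
  move=> a b; have [Pw _ _] := wP a.
  by apply: fa_ext (Pw 0 b) _ => B'; rewrite /G mxE.
(* This determinant is 1 at [B], and where it is non-zero the rows of [G B'] are independent. *)
pose D B' := \det (G B' *m pinvmx g).
have PD : polyfun D by apply: fa_det => //; apply: mxin_mul => //;
  exact: mxin_cst.
exists [set B' | D B' = 0]; split; first exact: zclosed_zeros.
  move=> /(_ B LB) /eqP; apply/negP; rewrite /D.
  have -> : G B = g by apply/row_matrixP => a; rewrite rowK;
    have [_ _ ->] := wP a.
  by rewrite mulmxVp // det1 oner_eq0.
move=> B' [LB' /eqP DB'] /=; rewrite /eps_rep; congr (_ - _)%N; apply/eqP.
rewrite eqn_leq maxr /=; last by apply/asboolP; exists B'.
suff freeG : row_free (G B') by rewrite -(eqP freeG); exact: mxrankS.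
apply/row_freeP; exists (pinvmx g *m invmx (G B' *m pinvmx g)).
by rewrite mulmxA mulmxV // unitmxE unitfE.
Qed.

Lemma eps_comp_generic d i (L : set (rep K Q d)) : L !=set0 ->
  generic_on L [set B | eps_rep B i = eps_comp i L].
Proof.
move=> /(@generic_eps d i L)[l genl]; rewrite /eps_comp.
by case: xgetP => [l' _ //|/(_ l)].
Qed.

Lemma dimv_subE (d : dimv I) i l j : (l <= d i)%N ->
  d j = (dimv_sub d i l j + (if j == i then l else 0))%N.
Proof.
move=> ld; rewrite /dimv_sub fsfunE; case: ifP => jd.
  by case: eqP => [->|]; rewrite ?addn0 // subnK.
have dj : d j = 0%N by apply: fsfun_dflt; rewrite jd.
by case: eqP => [ji|]; rewrite ?dj //; move: ld;
  rewrite -ji dj leqn0 => /eqP ->.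
Qed.

Definition restrictions d i l (L : set (rep K Q d)) : set (rep K Q (dimv_sub d
  i l)) :=
  [set x | exists2 B, (L `&` [set B | eps_rep B i = l]) B & iso_restriction B
    (W_family i B) x].

Arguments restrictions {d} i l L.

(** The right-hand side is irreducible, lies in [N_ d] and contains [L], whose generic points belong
    to the stratum; maximality of [L] gives equality. *)
Lemma component_stratum d i (L : set (rep K Q d)) (l := eps_comp i L) :
    irr_component (@N_ K I Q d) L ->
  [/\ (l <= d i)%N, restrictions i l L `<=` @N_ K I Q (dimv_sub d i l) &
      L = N_ d `&` vanishing_closure (stratum i (restrictions i l L))].
Proof.
move=> [LN irrL maxL]; have [L0 _] := irrL.
have [[B [LB epsB]] irrLl denseL] :=
  generic_dense (zirreducible_irr irrL) (eps_comp_generic i L0).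
have ld : (l <= d i)%N by rewrite /l -epsB leq_subr.
have dE j := dimv_subE j ld.
have RN x : restrictions i l L x -> N_ (dimv_sub d i l) x /\ eps_rep x i = 0%N.
  by move=> [B' [LB' _] B'x]; exact: restrict_N dE _ _ (LN _ LB') B'x.
split=> // [x /RN[] //|].
have irrR : irr (@polyfun K I Q _) (restrictions i l L).
  by apply: irr_restrictions => // B' [].
have irrY := irr_stratum dE RN irrR.
have LY : (L `&` [set B | eps_rep B i = l]) `<=` stratum i (restrictions i l L).
  move=> B' [LB' epsB']; split; first exact: LN.
  by have [x B'x] := restriction_exists dE epsB'; exists x => //; exists B'.
apply/esym; apply: maxL => //.
- apply: irr_zirreducible; last first.
    apply: irr_dense irrY => [B' YB'|B' []//].
    by split; [case: YB'|move=> f _; exact].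
  exists B; split; first exact: LN.
  by move=> f _; apply; apply: LY.
move=> B' LB'; split; first exact: LN.
by move=> f Pf fY; apply: denseL => // y /LY; exact: fY.
Qed.

Lemma e_pow_inj d i (L1 L2 : set (rep K Q d)) l :
    irr_component (@N_ K I Q d) L1 -> irr_component (@N_ K I Q d) L2 ->
    eps_comp i L1 = l -> eps_comp i L2 = l -> e_pow i l L1 = e_pow i l L2 ->
  L1 = L2.
Proof.
move=> C1 C2 e1 e2 epow.
have [ld RN1 L1E] := component_stratum i C1.
have [_ RN2 L2E] := component_stratum i C2.
rewrite e1 in ld RN1 L1E; rewrite e2 in RN2 L2E.
have dE j := dimv_subE j ld.
have sub L L' : irr_component (@N_ K I Q d) L' ->
    restrictions i l L `<=` N_ (dimv_sub d i l) -> e_pow i l L = e_pow i l L' ->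
    @vanishing_closure d (stratum i (restrictions i l L)) `<=`
    vanishing_closure (stratum i (restrictions i l L')).
  move=> [L'N _ _] RN eLL' B HB f Pf fY'; apply: HB => // B' [NB' [x Rx B'x]].
  apply/eqP; apply: contrapT => /negP fB'.
  have [f' [Pf' f'x sec]] := stratum_section dE Pf NB' B'x fB'.
  (* [x] lies in the closure of the restrictions of [L'], so [f'] is non-zero at one of them, and
     from there [f] is non-zero on the stratum of [L']. *)
  have Ex : e_pow i l L' x.
    rewrite -eLL'; split; last exact: RN.
    apply: sub_zclosure; case: Rx => B'' [LB'' epsB''] B''x.
    by exists B''.
  have [/zclosure_vanishing Hx _] := Ex.
  move: f'x; rewrite (Hx f' Pf') ?eqxx // => x' [B'' [LB'' epsB'' B''x']].
  apply/eqP; apply: contrapT => /negP f'x'.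
  have [Nx' epsx'] := restrict_N dE (L'N _ LB'') B''x'.
  have [B3 [NB3 B3x' /negP]] := sec x' Nx' epsx' f'x'; apply; apply/eqP.
  by apply: fY'; split=> //; exists x' => //; exists B''.
rewrite L1E L2E; apply/seteqP; split=> B [NB VB]; split=> //; exact: sub VB.
Qed.

End Components.

Lemma pick_optP (T : Type) (P : T -> Prop) x : pick_opt P = Some x -> P x.
Proof.
by rewrite /pick_opt; case: pselect => // exP [<-]; exact: projT2 (cid exP).
Qed.

Lemma pick_opt_unique (T : Type) (P : T -> Prop) x : P x ->
  (forall y, P y -> y = x) -> pick_opt P = Some x.
Proof.
move=> Px uniqx; rewrite /pick_opt; case: pselect => [exP|[]]; last by exists x.
by congr Some; apply: uniqx; exact: projT2 (cid exP).
Qed.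

(** * From injectivity to the crystal axioms *)

Section Crystal.
Variables (K : numClosedFieldType) (I : countType) (Q : quiver I).
Implicit Types b : crys K Q.

Lemma crys_eps_leq i b : (crys_eps i b <= projT1 b i)%N.
Proof.
case: b => d [L CL]; rewrite /crys_eps /=.
by have [] := component_stratum i CL.
Qed.

(** The weights may differ a priori. Because [dimv_sub] truncates, recovering them from the result
    takes the bound [crys_eps_leq]. *)
Lemma crys_e_pow_inj i l b1 b2 : crys_eps i b1 = l -> crys_eps i b2 = l ->
  crys_e_pow i l b1 = crys_e_pow i l b2 -> b1 = b2.
Proof.
move=> e1 e2 epow; have l1 := crys_eps_leq i b1; have l2 := crys_eps_leq i b2.
move: l1 l2 e1 e2 epow; case: b1 => d1 [L1 C1]; case: b2 => d2 [L2 C2] /=.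
move=> l1 l2 e1 e2; rewrite /crys_e_pow /= => epow.
rewrite e1 in l1; rewrite e2 in l2.
have d12 : d1 = d2.
  have /= dE := congr1 (@projT1 _ _) epow.
  by apply/fsfunP => j; rewrite (dimv_subE j l1) (dimv_subE j l2) dE.
subst d2; have {}epow : e_pow i l L1 = e_pow i l L2.
  by apply: Eqdep_dec.inj_pair2_eq_dec epow; exact: eq_comparable.
have L12 := e_pow_inj C1 C2 e1 e2 epow; subst L2.
by rewrite (Prop_irrelevance C1 C2).
Qed.

Lemma crys_e_pow_invP i l X b :
  crys_e_pow_inv i l X = Some b <-> crys_eps i b = l /\ crys_e_pow i l b = X.
Proof.
split=> [/(@pick_optP _ _ b)//|[eb Xb]];
  apply: pick_opt_unique => // b' [eb' Xb'].
by apply: (crys_e_pow_inj eb' eb); rewrite Xb Xb'.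
Qed.

(** The arrow of the crystal graph from [b] to [b'], phrased without choosing inverses so that it
    can be read from either end. *)
Definition crys_edge i b b' : Prop :=
  crys_eps i b' = (crys_eps i b).+1 /\
  crys_e_pow i (crys_eps i b).+1 b' = crys_e_pow i (crys_eps i b) b.

Lemma crys_fP i b b' : crys_f i b = Some b' <-> crys_edge i b b'.
Proof. exact: crys_e_pow_invP. Qed.

Lemma crys_eP i b b' : crys_e i b' = Some b <-> crys_edge i b b'.
Proof.
rewrite /crys_e /crys_edge; case eb': (crys_eps i b') => [|l].
  by split=> // -[].
split=> [/crys_e_pow_invP[-> ->]//|[[->] epow]].
by apply/crys_e_pow_invP.
Qed.

Lemma root_of_finsupp (D : BC_datum (cartan Q)) (d : dimv I) (A : {fset I}) :
  {subset finsupp d <= A} -> root_of D d = \sum_(j <- A) sroot D j *+ d j.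
Proof.
move=> dA; rewrite /root_of (@big_fset_incl _ _ _ _ _ A) //;
  first exact/fsubsetP.
by move=> j _; rewrite mem_finsupp negbK => /eqP ->; rewrite mulr0n.
Qed.

Lemma crys_edge_wt (D : BC_datum (cartan Q)) i b b' : crys_edge i b b' ->
  crys_wt D b = crys_wt D b' + sroot D i.
Proof.
case=> eb' epow; have lb := crys_eps_leq i b; have lb' := crys_eps_leq i b'.
(* The equality in [crys_edge] is one of dependent pairs, and its first components already fix the
   relation between the weights. *)
rewrite eb' in lb'; have /= dE := congr1 (@projT1 _ _) epow.
rewrite /crys_wt; move: (projT1 b) (projT1 b') lb lb' dE => d d'.
move: (crys_eps i b) => l lb lb' dE.
have d'E j : d' j = (d j + (j == i))%N.
  rewrite (dimv_subE j lb') (dimv_subE j lb) dE.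
  by case: eqP => _; rewrite ?addn0 // addn1 addnS.
have id' : i \in finsupp d' by rewrite mem_finsupp d'E eqxx addn1.
rewrite (@root_of_finsupp D d (finsupp d')); last first.
  by move=> j; rewrite !mem_finsupp d'E; case: (d j).
rewrite /root_of; under [in RHS]eq_bigr => j _ do rewrite d'E mulrnDr.
rewrite big_split /=.
have -> : \sum_(j <- finsupp d') sroot D j *+ (j == i) = sroot D i.
  rewrite (bigD1_seq i) ?fset_uniq //= eqxx mulr1n big1 ?addr0 // => j /negPf
    ->.
  by rewrite mulr0n.
by rewrite opprD addrNK.
Qed.

Lemma crys_edge_eps' i b b' : crys_edge i b b' ->
  crys_eps' i b' = omap (fun x => x + (if cartan Q i i == 2 then 1 else 0))
    (crys_eps' i b).
Proof.
by case=> eb' _; rewrite /crys_eps' eb'; case: eqP => _ /=;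
  rewrite ?addr0 // -addn1.
Qed.

Lemma crys_edge_phi (D : BC_datum (cartan Q)) i b b' : crys_edge i b b' ->
  crys_phi D i b' = omap (fun x => x - cartan Q i i +
    (if cartan Q i i == 2 then 1 else 0)) (crys_phi D i b).
Proof.
move=> e; rewrite /crys_phi (crys_edge_eps' e) (crys_edge_wt D e) raddfD /=.
by rewrite coroot_sroot; congr Some; ring.
Qed.

End Crystal.

Theorem theorem3p5 (R : realType) (I : countType) (Q : quiver I)
    (D : BC_datum (cartan Q)) :
  @is_crystal I (cartan Q) D (crys R[i] Q)
    (@crys_wt R[i] I Q D)
    (@crys_e R[i] I Q) (@crys_f R[i] I Q)
    (@crys_eps' R[i] I Q) (@crys_phi R[i] I Q D).
Proof.
have re i : cartan Q i i = 2 -> (cartan Q i i == 2) = true by move=> ->.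
have im i : cartan Q i i <= 0 -> (cartan Q i i == 2) = false.
  by move=> a_le0; apply/eqP => a2; rewrite a2 in a_le0.
split.
- by move=> i b b' /crys_eP /(crys_edge_wt D).
- by move=> i b b' /crys_fP /(crys_edge_wt D) ->; rewrite addrK.
- by move=> i b; rewrite /crys_phi /crys_eps' /= addrC.
- by move=> i b b'; apply: (iff_trans (crys_fP i b b')); apply: iff_sym; exact: crys_eP.
- move=> i b b' a2 /crys_eP e.
  rewrite (crys_edge_phi D e) (crys_edge_eps' e) (re i a2) a2 /=.
  by split; congr Some; ring.
- move=> i b b' a_le0 /crys_eP e.
  rewrite (crys_edge_phi D e) (crys_edge_eps' e) (im i a_le0) /=.
  by split; congr Some; ring.
- move=> i b b' a2 /crys_fP e.
  rewrite (crys_edge_phi D e) (crys_edge_eps' e) (re i a2) a2 /=.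
  by split; congr Some; ring.
- move=> i b b' a_le0 /crys_fP e.
  rewrite (crys_edge_phi D e) (crys_edge_eps' e) (im i a_le0) /=.
  by split; congr Some; ring.
- by [].
Qed.
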